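(* There is $n_0$ such that for all $n \geq n_0$, every $(n,3n-2)$-multigraph contains a rainbow matching of size $n$.
   Context: An $(n,v)$-multigraph is a multigraph whose edges are coloured with a set of $n$ colours (parallel edges between the same pair of vertices are allowed, with distinct colours) such that, for each colour $c$, the colour class of $c$ (the simple graph formed by the edges of colour $c$) is a vertex-disjoint union of non-trivial cliques (cliques with at least $2$ vertices) which together have at least $v$ vertices. A rainbow matching is a matching whose edges have pairwise distinct colours. *)

(* Defs.v *)
From mathcomp Require Import all_boot.
Set Implicit Arguments. Unset Strict Implicit. Unset Printing Implicit Defensive.

(* A multigraph on a finite vertex type V whose edges are coloured with the
   n colours 'I_n is a set of coloured edges (c, e), where e is a 2-element
   vertex set.  Parallel edges between the same pair of vertices are allowed,
   provided they have distinct colours (automatic from the set representation). *)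
Section Multigraph.
Variables (n : nat) (V : finType).

Definition is_edge (e : {set V}) : bool := #|e| == 2.

Definition colour_class (M : {set 'I_n * {set V}}) (c : 'I_n) : {set {set V}} :=
  [set e.2 | e in M & e.1 == c].

Definition clique_union (Es : {set {set V}}) (P : {set {set V}}) : Prop :=
  [/\ trivIset P,
      (forall B, B \in P -> 2 <= #|B|) &
      Es = [set e : {set V} | is_edge e && [exists B in P, e \subset B]]].

Definition nv_multigraph (v : nat) (M : {set 'I_n * {set V}}) : Prop :=
  (forall e, e \in M -> is_edge e.2) /\
  (forall c : 'I_n, exists P : {set {set V}},
      clique_union (colour_class M c) P /\ v <= #|cover P|).

Definition rainbow_matching (R : {set 'I_n * {set V}}) : Prop :=
  forall e f, e \in R -> f \in R -> e != f ->
    [disjoint e.2 & f.2] /\ e.1 != f.1.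

End Multigraph.

(* Main.v *)
(* A colour class may be cut into cliques of size 2 and 3.  Restricting to a maximal set of
   matched colours and one further colour [o], suppose that a rainbow matching [g] misses only
   [o].  Call the matching edges blobs and let [W] be the set of unmatched vertices.  If the
   missing colour joins an end of the blob [j] to a vertex of [W], switching to that edge
   makes [j] the missing colour; as no matching is full, the missing colour never has an edge
   inside the unmatched part.  Since every colour covers at least [n] vertices of [W], any
   colour that can be made missing leads to about half of the other colours.  A sparse-cut
   argument yields a set [A] of colours inside which short chains of switches join any two
   colours while avoiding bounded sets, and an edge count then shows that [A] contains almost
   all colours.  Chains that switch one blob with two different colours force almost every
   blob [j] to span a triangle, with one and the same vertex [ctr j] of [W], in at least
   three quarters of the colours.  Given these triangles, the edges of a regular colour [c]
   at [W] avoid [ctr c] and the blob [c], so its [n - 1] remaining vertices in [W] hit both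
   ends of one of the [n - 2] other blobs; this blob cannot be regular, and an irregular one
   serves only boundedly many colours. *)

From Stdlib Require Import ClassicalEpsilon.
Require Import Defs.
From mathcomp Require Import all_boot zify.
Set Implicit Arguments. Unset Strict Implicit. Unset Printing Implicit Defensive.

(** * Counting *)

(** The obstacle is that every switch uses up a vertex of [W], while the colours entering a blob may
    nearly all do so through a few vertices. Such vertices are called heavy for the blob, and routes
    leave a blob only through other ones. Routes are grown backwards from their last colour:
    reserving a light exit of a blob spoils at most [h] of the colours entering it, so many
    predecessors survive. The sparse-cut step is there because out-degrees near n/2 say nothing
    about in-degrees, so the colours that can be made missing might fall into pieces with no way
    back. Two colours that switch the same blob at opposite ends through different vertices would
    extend the matching. This rule turns reachability into structure: it makes the vertices used at
    a blob almost constant, and one vertex cannot serve most colours at two blobs. The constants are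
    hierarchical: [k] is absolute; [T], [d], [K], [f], [Q], [q] depend on [k] alone; [h] and [s] are
    fixed small fractions of [n]. The exact value 3n-2 is decisive in the last count, n-1 vertices
    against n-2 blobs. *)

Lemma sum_card_rel (A B : finType) (r : A -> B -> bool) :
  \sum_a #|[set b | r a b]| = \sum_b #|[set a | r a b]|.
Proof.
have cardE (T : finType) (p : pred T) : #|[set x | p x]| = \sum_x (p x : nat).
  by rewrite -sum1dep_card [RHS](eq_bigr (fun x => if p x then 1 else 0)) -?big_mkcond // => x _; case: (p x).
rewrite (eq_bigr (fun a => \sum_b (r a b : nat))); last by move=> a _; rewrite cardE.
by rewrite exchange_big; apply: eq_bigr => b _; rewrite cardE.
Qed.

Lemma sum_leq_const (A : finType) (f : A -> nat) k :
  (forall a, f a <= k) -> \sum_a f a <= #|A| * k.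
Proof. by move=> H; rewrite -sum_nat_const; apply: leq_sum. Qed.

Lemma sum_in_leq_const (A : finType) (S : {set A}) (f : A -> nat) k :
  (forall a, a \in S -> f a <= k) -> \sum_(a in S) f a <= #|S| * k.
Proof. by move=> H; rewrite -sum_nat_const; apply: leq_sum => a; apply: H. Qed.

Lemma sum_in_geq_const (A : finType) (S : {set A}) (f : A -> nat) k :
  (forall a, a \in S -> k <= f a) -> #|S| * k <= \sum_(a in S) f a.
Proof. by move=> H; rewrite -sum_nat_const; apply: leq_sum => a; apply: H. Qed.

Lemma markov (A : finType) (f : A -> nat) h :
  #|[set a | h <= f a]| * h <= \sum_a f a.
Proof.
rewrite -sum_nat_const big_mkcond /=; apply: leq_sum => a _.
by rewrite inE; case: ifP.
Qed.

Lemma sum_card_leq (A B : finType) (r : A -> B -> bool) k :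
  (forall b, #|[set a | r a b]| <= k) -> \sum_a #|[set b | r a b]| <= #|B| * k.
Proof. by move=> H; rewrite sum_card_rel; apply: sum_leq_const. Qed.

Lemma markov_rel (A B : finType) (r : A -> B -> bool) h k :
  (forall b, #|[set a | r a b]| <= k) ->
  #|[set a | h <= #|[set b | r a b]|]| * h <= #|B| * k.
Proof. by move=> H; apply: leq_trans (markov _ _) (sum_card_leq H). Qed.

Lemma card_exists_leq (A B : finType) (Z : {set A}) (r : A -> B -> bool) k :
  (forall a, a \in Z -> #|[set b | r a b]| <= k) ->
  #|[set b | [exists a in Z, r a b]]| <= #|Z| * k.
Proof.
move=> H.
suff -> : [set b | [exists a in Z, r a b]] = \bigcup_(a in Z) [set b | r a b].
  apply: leq_trans (sum_in_leq_const H).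
  elim/big_rec2: _ => [|a m S _ IH]; first by rewrite cards0.
  by apply: leq_trans (leq_card_setU _ _).1 _; rewrite leq_add2l.
apply/setP => b; rewrite inE; apply/exists_inP/bigcupP.
  by case=> a aZ rab; exists a; rewrite ?inE.
by case=> a aZ; rewrite inE => rab; exists a.
Qed.

Lemma card_inj_on (A B : finType) (S : {set A}) (S' : {set B}) (f : A -> B) :
  {in S &, injective f} -> (forall a, a \in S -> f a \in S') -> #|S| <= #|S'|.
Proof.
move=> inj sub; rewrite -(card_in_imset inj); apply: subset_leq_card.
by apply/subsetP => _ /imsetP [a aS ->]; apply: sub.
Qed.

(** If each of the first [k] steps added more than |A|/k points, the sets would outgrow [A]. It
    serves twice: for the colours that can be made missing, and for the layers of [reach]. *)
Lemma slow_growth (A : finType) (F : nat -> {set A}) k :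
  0 < k -> (forall t, F t \subset F t.+1) ->
  exists2 t, t < k & k * #|F t.+1 :\: F t| <= #|A|.
Proof.
move=> k0 mono.
have subF t : #|F t.+1 :\: F t| = #|F t.+1| - #|F t|.
  by rewrite cardsD (setIidPr (mono t)).
have monoc t : #|F t| <= #|F t.+1| by apply: subset_leq_card.
case: (boolP [exists t : 'I_k, k * #|F t.+1 :\: F t| <= #|A|]) => [/existsP [t Ht]|].
  by exists t.
rewrite negb_exists => /forallP Hn.
(* The extra [m] records that each step is too large by at least one; at [m = k] it contradicts the
   size of [A]. *)
have grow m : m <= k -> m * #|A| + m <= k * #|F m|.
  elim: m => [|m IH] mk //; have := IH (ltnW mk).
  have := Hn (Ordinal mk); rewrite -ltnNge /= subF.
  by have := monoc m; rewrite mulnBr mulSn; nia.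
have Hm : #|F k| <= #|A| by apply: max_card.
by have := grow k (leqnn _); have := leq_mul (leqnn k) Hm; lia.
Qed.

Lemma subset_card_ltn_ex (A : finType) (S T : {set A}) :
  #|T| < #|S| -> exists2 x, x \in S & x \notin T.
Proof.
move=> H; apply/subsetPn; apply: contraL H => sub.
by rewrite -leqNgt subset_leq_card.
Qed.

Lemma cardsU_leq (A : finType) (S T : {set A}) : #|S :|: T| <= #|S| + #|T|.
Proof. exact: (leq_card_setU S T).1. Qed.

Lemma ex_fin_choice (A : finType) (B : eqType) (b0 : B) (P : pred A) (R : A -> B -> Prop) :
  (forall a, P a -> exists b, R a b) -> exists f : A -> B, forall a, P a -> R a (f a).
Proof.
move=> H.
have H' a : exists b, P a -> R a b.
  by case: (boolP (P a)) => [/H [b Rb]|_]; [exists b | exists b0].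
by have [f Hf] := fin_all_exists H'; exists f.
Qed.

(** * Expanding cores of digraphs *)

Section Digraph.
Context (C : finType) (n : nat).
Hypothesis nE : #|C| = n.
Implicit Types (arc : rel C) (A B S T : {set C}).

Lemma card_leq_n S : #|S| <= n. Proof. by rewrite -nE; apply: max_card. Qed.

Definition outn arc l := [set c | arc l c].
Definition arcs arc S T := \sum_(l in S) #|outn arc l :&: T|.
(** Linearly many predecessors are demanded, rather than one, so that bounded sets can be forbidden
    later when a path is traced back. *)
Definition frontier k A arc B :=
  [set c in A | n <= k * #|[set l in B | arc l c]|].
Fixpoint reach k A arc B t : {set C} :=
  if t is t'.+1 then reach k A arc B t' :|: frontier k A arc (reach k A arc B t')
  else B.

Lemma arcs_swap arc S T :
  arcs arc S T = \sum_(c in T) #|[set l in S | arc l c]|.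
Proof.
rewrite /arcs big_mkcond [RHS]big_mkcond /=.
transitivity (\sum_a #|[set b | [&& a \in S, b \in T & arc a b]]|).
  apply: eq_bigr => a _; case: ifP => aS /=.
    by apply: eq_card => b; rewrite !inE andbC.
  by rewrite (_ : finset _ = set0) ?cards0 //; apply/setP => b; rewrite !inE.
rewrite sum_card_rel; apply: eq_bigr => b _; case: ifP => bT.
  by apply: eq_card => a; rewrite !inE.
by rewrite (_ : finset _ = set0) ?cards0 //; apply/setP => a; rewrite !inE andbF.
Qed.

Lemma arcsSl arc S S' T : S \subset S' -> arcs arc S T <= arcs arc S' T.
Proof.
move=> sub; rewrite /arcs big_mkcond [leqRHS]big_mkcond; apply: leq_sum => a _.
by case: ifP => // /(subsetP sub) ->.
Qed.

Lemma arcs_compl arc S A : S \subset A ->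
  arcs arc S (~: S) = arcs arc S (A :\: S) + arcs arc S (~: A).
Proof.
move=> sub; rewrite /arcs -big_split /=; apply: eq_bigr => a _.
rewrite -(cardsID A (_ :&: ~: S)); congr (_ + _); apply: eq_card => b; rewrite !inE.
  by case: (arc a b); case: (b \in A); case: (b \in S).
have /implyP := subsetP sub b.
by case: (arc a b); case: (b \in A); case: (b \in S).
Qed.

Lemma reach_subset k A arc B t : B \subset A -> reach k A arc B t \subset A.
Proof.
move=> BA; elim: t => //= t IH; rewrite subUset IH /=.
by apply/subsetP => c; rewrite inE => /andP [].
Qed.

Lemma reach_le k A arc B t t' : t <= t' -> reach k A arc B t \subset reach k A arc B t'.
Proof.
move=> /subnK <-; elim: (t' - t) => //= m IH; apply: subset_trans IH _; exact: subsetUl.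
Qed.

(* The core is a subset [A] of [L] of at least [n/50] points minimising
   [k * arcs A (~: A) + n * #|A|]: comparing with [L] shows that few arcs leave it,
   comparing with its subsets shows that every large subset expands inside it. *)
Section Core.
Context (arc : rel C) (k : nat) (L : {set C}).
Hypothesis Lbig : n <= 50 * #|L|.
Hypothesis k_large : 1000 <= k.
Hypothesis n_large : 1000 <= n.
Hypothesis Ldeg : forall l, l \in L -> 9 * n <= 20 * #|outn arc l|.
Hypothesis Lclosed : k * arcs arc L (~: L) <= n * n.

Let weight S := k * arcs arc S (~: S) + n * #|S|.

Context (A : {set C}).
Hypothesis AL : A \subset L.
Hypothesis Abig : n <= 50 * #|A|.
Hypothesis A_min : forall S, S \subset L -> n <= 50 * #|S| -> weight A <= weight S.

Lemma core_closed : k * arcs arc A (~: A) <= 2 * (n * n).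
Proof.
have := A_min (subxx _) Lbig; rewrite /weight.
have : #|L| <= n by apply: card_leq_n.
by have := Lclosed; nia.
Qed.

(** Passing from [A] to [B] creates only the boundary arcs from [B] to [A :\: B], as arcs leaving
    [A] do not increase; minimality makes them pay for the lost points. *)
Let A_expand B : B \subset A -> n <= 50 * #|B| -> n * #|A :\: B| <= k * arcs arc B (A :\: B).
Proof.
move=> BA Bbig; have := A_min (subset_trans BA AL) Bbig; rewrite /weight (arcs_compl _ BA).
have := arcsSl arc (~: A) BA.
have : #|A :\: B| + #|B| = #|A|.
  by rewrite addnC -(cardsID B A) (setIidPr BA).
nia.
Qed.

Let typ := [set i in A | n <= 4 * #|outn arc i :&: A|].

(** An atypical point sends at least 9n/20 - n/4 = n/5 arcs out of [A], and [core_closed] leaves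
    room for few such points. *)
Lemma core_typ : k * #|A :\: typ| <= 10 * n.
Proof.
have H : #|A :\: typ| * n <= 5 * arcs arc A (~: A).
  apply: leq_trans (leq_mul (leqnn 5) (arcsSl arc _ (subsetDl A typ))).
  rewrite /arcs big_distrr /=; apply: sum_in_geq_const => a.
  rewrite !inE => /andP [aN aA]; rewrite aA /= -ltnNge in aN.
  have := Ldeg (subsetP AL _ aA); rewrite -(cardsID A (outn arc a)) -setDE; lia.
have := core_closed; nia.
Qed.

Let typ_small : 100 * #|A :\: typ| <= n.
Proof.
have := leq_trans (leq_mul k_large (leqnn _)) core_typ; lia.
Qed.

Lemma core_card : n <= 4 * #|A|.
Proof.
have [a aA aN] : exists2 a, a \in A & a \notin A :\: typ.
  by apply: subset_card_ltn_ex; have := typ_small; lia.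
have : a \in typ by move: aN; rewrite inE aA andbT negbK.
rewrite inE => /andP [_ H]; apply: leq_trans H _; rewrite leq_mul2l /=.
exact: subset_leq_card (subsetIr _ _).
Qed.

(** Let [J] be the points of low in-degree. If [J] is non-empty, [A :\: J] is still large, so by
    expansion it sends n|J|/k arcs into [J], more than the definition of [J] allows. *)
Let A_indeg c : c \in A -> n <= k * #|[set l in A | arc l c]|.
Proof.
set J := [set c in A | k * #|[set l in A | arc l c]| < n].
have JA : J \subset A by apply/subsetP => x; rewrite inE => /andP [].
suff J0 : J = set0.
  move=> cA; rewrite leqNgt; apply/negP => H.
  have : c \in J by rewrite inE cA.
  by rewrite J0 inE.
apply/eqP; apply: contraT => Jn0.
have J0 : 0 < #|J| by rewrite card_gt0.
have cardAJ : #|A :\: J| + #|J| = #|A|.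
  by rewrite addnC -(cardsID J A) (setIidPr JA).
have typA : #|A :\: typ| + #|typ| = #|A|.
  have sub : typ \subset A by apply/subsetP => x; rewrite inE => /andP [].
  by rewrite addnC -(cardsID typ A) (setIidPr sub).
(* The [+ 1] carries the strict inequality in the definition of [J] through the sum; the final
   contradiction rests on it. *)
have Jsmall : \sum_(c in J) (k * #|[set l in A | arc l c]| + 1) <= #|J| * n.
  by apply: sum_in_leq_const => x; rewrite inE => /andP [_]; rewrite addn1.
(* Typical points send |typ| n/4 arcs into [A]. Points of [J] absorb fewer than n/k each, so the
   points outside [J] must be numerous enough to take the rest. *)
have big : n <= 50 * #|A :\: J|.
  have H1 : #|typ| * n <= 4 * arcs arc A A.
    have sub : typ \subset A by apply/subsetP => x; rewrite inE => /andP [].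
    apply: leq_trans (leq_mul (leqnn 4) (arcsSl arc _ sub)).
    by rewrite /arcs big_distrr /=; apply: sum_in_geq_const => a; rewrite inE => /andP [].
  have H2 : k * arcs arc A A <= k * (#|A :\: J| * n) + #|J| * n.
    rewrite arcs_swap (big_setID J) /= (setIidPr JA) mulnDr addnC.
    apply: leq_add.
      by rewrite leq_mul2l sum_in_leq_const ?orbT // => x _; apply: card_leq_n.
    apply: leq_trans Jsmall; rewrite big_distrr /=; apply: leq_sum => x _; lia.
  have H3 : k * #|typ| <= 4 * k * #|A :\: J| + 4 * n.
    rewrite -(@leq_pmul2r n); last by lia.
    by have := leq_mul (leqnn k) H1; have := leq_mul (card_leq_n J) (leqnn n); lia.
  have H4 : 1000 * n <= k * n by rewrite leq_mul2r k_large orbT.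
  have H5 : 1000 * #|typ| <= 4000 * #|A :\: J| + 4 * n.
    by rewrite -(@leq_pmul2l k); lia.
  by have := typ_small; have := core_card; lia.
have := A_expand (subsetDl A J) big.
have -> : A :\: (A :\: J) = J by rewrite setDDr setDv set0U; apply/setIidPr.
rewrite arcs_swap => H.
suff : k * (\sum_(c0 in J) #|[set l in A :\: J | arc l c0]|) + #|J| <= #|J| * n by lia.
apply: leq_trans Jsmall; rewrite big_split /= sum1_card leq_add2r big_distrr /=.
apply: leq_sum => x _; rewrite leq_mul2l; apply/orP; right.
by apply: subset_leq_card; apply/subsetP => l; rewrite !inE -andbA => /and3P [_ -> ->].
Qed.

(** Among 4k² layers one adds at most n/(4k²) points. Expansion then leaves at most n/(2k) points of
    [A] unreached, so each point of [A] keeps n/k - n/(2k) in-arcs from the reached set and enters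
    the next layer. *)
Lemma core_reach arc' B0 : subrel arc' arc ->
  (forall l, #|outn arc l :\: outn arc' l| <= 8) ->
  B0 \subset A -> n <= 8 * #|B0| ->
  reach (2 * k) A arc (frontier (2 * k) A arc' B0) (4 * k * k) = A.
Proof.
move=> sub loss B0A B0big; set B1 := frontier _ _ _ B0.
have B1A : B1 \subset A by apply/subsetP => c; rewrite inE => /andP [].
have B1big : n <= 50 * #|B1|.
  have H0 : #|A :\: typ| + #|B0 :&: typ| >= #|B0|.
    rewrite -(cardsID typ B0) addnC leq_add2r; apply: subset_leq_card; exact: setSD.
  (* The 8 arcs that [arc'] may lack at each point become 32 through the factor 4. *)
  have H1 : #|B0 :&: typ| * n <= 4 * arcs arc' B0 A + 32 * n.
    have H : #|B0 :&: typ| * (n - 32) <= 4 * arcs arc' B0 A.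
      apply: leq_trans (leq_mul (leqnn 4) (arcsSl arc' _ (subsetIl B0 typ))).
      rewrite /arcs big_distrr /=; apply: sum_in_geq_const => a.
      rewrite !inE => /and3P [_ _ aT].
      have : #|outn arc a :&: A| <= #|outn arc' a :&: A| + #|outn arc a :\: outn arc' a|.
        apply: leq_trans (cardsU_leq _ _); apply: subset_leq_card; apply/subsetP => x.
        by rewrite !inE => /andP [-> ->]; case: (arc' a x).
      by have := loss a; lia.
    have := card_leq_n (B0 :&: typ); have := leq_mul (leqnn #|B0 :&: typ|) n_large; move: H; rewrite mulnBr; lia.
  have H2 : 2 * k * arcs arc' B0 A <= 2 * k * (#|B1| * n) + n * n.
    rewrite arcs_swap (big_setID B1) /= (setIidPr B1A) mulnDr.
    apply: leq_add.
      by rewrite leq_mul2l sum_in_leq_const ?orbT // => x _; apply: card_leq_n.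
    rewrite big_distrr /=; apply: leq_trans (_ : #|A :\: B1| * n <= _).
      apply: sum_in_leq_const => x; rewrite !inE => /andP [xN xA].
      by rewrite xA /= -ltnNge in xN; apply: ltnW.
    by rewrite leq_mul2r card_leq_n orbT.
  have H3 : k * #|B0 :&: typ| <= 4 * k * #|B1| + 2 * n + 32 * k.
    rewrite -(@leq_pmul2r n); last by lia.
    by have := leq_mul (leqnn k) H1; lia.
  have H4 : 1000 * n <= k * n by rewrite leq_mul2r k_large orbT.
  have H5 : 1000 * #|B0 :&: typ| <= 4000 * #|B1| + 2 * n + 32 * 1000.
    by rewrite -(@leq_pmul2l k); lia.
  by have := typ_small; lia.
set R := reach (2 * k) A arc B1.
have [|t tlt] := @slow_growth C R (4 * k * k) _ (fun t => reach_le _ _ _ _ (leqnSn t)).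
  by lia.
rewrite nE => Ht.
have RA t' : R t' \subset A by apply: reach_subset.
apply/eqP; rewrite eqEsubset RA /=; apply: subset_trans (reach_le _ _ _ _ tlt).
have Rsmall : 2 * k * #|A :\: R t| <= n.
  have big : n <= 50 * #|R t|.
    apply: leq_trans B1big _; rewrite leq_mul2l /=; apply: subset_leq_card.
    exact: (reach_le _ _ _ _ (leq0n t)).
  have := A_expand (RA t) big; rewrite arcs_swap => H.
  (* A point of the next layer may absorb up to n arcs, one that stays outside fewer than n/(2k). *)
  have H2 : 2 * k * (\sum_(c in A :\: R t) #|[set l in R t | arc l c]|) <=
            2 * k * (#|R t.+1 :\: R t| * n) + #|A :\: R t| * n.
    rewrite (big_setID (R t.+1)) /= mulnDr; apply: leq_add.
      rewrite leq_mul2l; apply/orP; right.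
      apply: leq_trans (_ : #|(A :\: R t) :&: R t.+1| * n <= _).
        by apply: sum_in_leq_const => x _; apply: card_leq_n.
      rewrite leq_mul2r; apply/orP; right; apply: subset_leq_card; apply/subsetP => x.
      by rewrite !inE => /andP [/andP [-> _] ->].
    rewrite big_distrr /=; apply: leq_trans (_ : #|A :\: R t :\: R t.+1| * n <= _).
      apply: sum_in_leq_const => x; rewrite /R /= !inE => /andP [xN /andP [_ xA]].
      by move: xN; rewrite negb_or xA /= -ltnNge => /andP [_ /ltnW].
    by rewrite leq_mul2r subset_leq_card ?orbT // subsetDl.
  have H3 : #|A :\: R t| <= 2 * k * #|R t.+1 :\: R t|.
    by rewrite -(@leq_pmul2r n); lia.
  by have := leq_mul (leqnn (2 * k)) H3; lia.
apply/subsetP => c cA; change (c \in R t :|: frontier (2 * k) A arc (R t)).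
rewrite inE; apply/orP; right; rewrite inE cA /=.
have := A_indeg cA.
have : #|[set l in A | arc l c]| <= #|[set l in R t | arc l c]| + #|A :\: R t|.
  apply: leq_trans (cardsU_leq _ _); apply: subset_leq_card; apply/subsetP => x.
  by rewrite !inE => /andP [-> ->]; rewrite andbT; case: (_ \in R t).
by move=> H; have := leq_mul (leqnn k) H; lia.
Qed.

End Core.

Lemma core_exists arc k (L : {set C}) :
  n <= 50 * #|L| -> 1000 <= k -> 1000 <= n ->
  (forall l, l \in L -> 9 * n <= 20 * #|outn arc l|) ->
  k * arcs arc L (~: L) <= n * n ->
  exists A : {set C},
  [/\ A \subset L, n <= 4 * #|A|, k * arcs arc A (~: A) <= 2 * (n * n),
      k * #|A :\: [set i in A | n <= 4 * #|outn arc i :&: A|]| <= 10 * n &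
      forall arc' B0, subrel arc' arc ->
        (forall l, #|outn arc l :\: outn arc' l| <= 8) ->
        B0 \subset A -> n <= 8 * #|B0| ->
        reach (2 * k) A arc (frontier (2 * k) A arc' B0) (4 * k * k) = A].
Proof.
move=> Lbig kl nl Ldeg Lclosed.
pose cand := [pred S : {set C} | (S \subset L) && (n <= 50 * #|S|)].
have candL : cand L by rewrite /cand /= subxx.
case: (arg_minnP (fun S => k * arcs arc S (~: S) + n * #|S|) candL) => A /andP [AL Abig] Amin.
have {}Amin S : S \subset L -> n <= 50 * #|S| ->
    k * arcs arc A (~: A) + n * #|A| <= k * arcs arc S (~: S) + n * #|S|.
  by move=> SL Sbig; apply: Amin; rewrite /= SL.
exists A; split=> //.
- exact: (core_card Lbig kl nl Ldeg Lclosed AL Abig Amin).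
- exact: (core_closed Lbig kl nl Lclosed AL Abig Amin).
- exact: (core_typ Lbig kl nl Ldeg Lclosed AL Abig Amin).
- exact: (core_reach Lbig kl nl Ldeg Lclosed AL Abig Amin).
Qed.

End Digraph.

(** * Matchings missing one colour *)

(** Transitivity off the diagonal makes the components cliques, and degree at most 2 bounds them by
    three vertices. *)
Definition clique_graph (V : finType) (e : rel V) : Prop :=
  [/\ symmetric e, irreflexive e,
      forall u v w, e u v -> e v w -> u != w -> e u w &
      forall u, #|[set v | e u v]| <= 2].

Definition covered (V : finType) (e : rel V) := [set v | [exists u, e u v]].

Section States.
Context (C V : finType).

(* [g c true] and [g c false] are the two ends of the matching edge of colour [c];
   the values at the missing colour [o] are junk. *)
Definition ends := C -> bool -> V.

Definition free (g : ends) o v := [forall c, forall b, (c != o) ==> (g c b != v)].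

Definition upd (g : ends) o u v : ends :=
  fun c b => if c == o then (if b then u else v) else g c b.

Lemma freeP (g : ends) o v : reflect (forall c b, c != o -> g c b != v) (free g o v).
Proof.
apply: (iffP forallP) => [H c b co|H c].
  by have /forallP/(_ b)/implyP/(_ co) := H c.
by apply/forallP => b; apply/implyP; apply: H.
Qed.

Lemma upd_other g o u v c b : c != o -> upd g o u v c b = g c b.
Proof. by rewrite /upd => /negbTE ->. Qed.

Context (E : C -> rel V).
Hypothesis Ecl : forall c, clique_graph (E c).

Definition full (g : ends) : Prop :=
  (forall c, E c (g c true) (g c false)) /\
  (forall c b c' b', g c b = g c' b' -> c = c' /\ b = b').

Definition state (g : ends) o : Prop :=
  (forall c, c != o -> E c (g c true) (g c false)) /\
  (forall c b c' b', c != o -> c' != o -> g c b = g c' b' -> c = c' /\ b = b').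

Lemma E_sym c u v : E c u v = E c v u. Proof. by case: (Ecl c) => ->. Qed.
Lemma E_irr c u : E c u u = false. Proof. by case: (Ecl c) => _ ->. Qed.
Lemma E_trans c u v w : E c u v -> E c v w -> u != w -> E c u w.
Proof. by case: (Ecl c) => _ _ H _; apply: H. Qed.
Lemma E_deg c u : #|[set v | E c u v]| <= 2. Proof. by case: (Ecl c). Qed.
Lemma E_neq c u v : E c u v -> u != v.
Proof. by apply: contraTneq => ->; rewrite E_irr. Qed.

Lemma state_ends g o c b : state g o -> c != o -> E c (g c b) (g c (~~ b)).
Proof. by move=> [H _] /H; case: b => //=; rewrite E_sym. Qed.

Lemma state_inj g o c b c' b' : state g o -> c != o -> c' != o ->
  g c b = g c' b' -> c = c' /\ b = b'.
Proof. by move=> [_ H]; apply: H. Qed.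

Lemma add_edge g o u v : state g o -> free g o u -> free g o v -> E o u v ->
  full (upd g o u v).
Proof.
move=> [Hg inj] /freeP fu /freeP fv Euv; split=> [c|c b c' b'].
  by rewrite /upd; case: eqVneq => [->|/Hg].
have uv := E_neq Euv.
have new d e e' : d != o -> g d e <> (if e' then u else v).
  by move=> Hd eq; case: e' eq => eq; [have := fu d e Hd | have := fv d e Hd]; rewrite eq eqxx.
rewrite /upd; case: (eqVneq c o) => [->|co]; case: (eqVneq c' o) => [->|c'o] e.
- by split=> //; case: b b' e uv => [] [] // ->; rewrite eqxx.
- by have := new _ _ _ c'o (esym e).
- by have := new _ _ _ co e.
- exact: inj.
Qed.

Lemma free_other g o c b v : free g o v -> c != o -> g c b != v.
Proof. by move/freeP; apply. Qed.

Lemma not_freeP g o v : reflect (exists c b, c != o /\ g c b = v) (~~ free g o v).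
Proof.
apply: (iffP idP) => [|[c [b [co <-]]]].
  rewrite negb_forall => /existsP [c]; rewrite negb_forall => /existsP [b].
  by rewrite negb_imply negbK => /andP [co /eqP e]; exists c, b.
by apply/negP => /freeP /(_ c b co); rewrite eqxx.
Qed.

(** The freed end [g j (~~ b)] is the gain: a later colour that joins it to a free vertex would
    extend the matching. *)
Lemma switch_edge g o j b w (g' := upd g o (g j b) w) :
  state g o -> j != o -> free g o w -> E o (g j b) w ->
  [/\ state g' j, free g' j (g j (~~ b)) &
      forall v, free g o v -> v != w -> free g' j v].
Proof.
move=> st jo fw Ew; have [Hg inj] := st; have w_other := free_other _ fw.
split.
- split=> [c|c b1 c' b2] cj.
    by rewrite /g' /upd; case: eqVneq => [->|/Hg].
  have new d e e' : d != j -> d != o -> g d e <> (if e' then g j b else w).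
    move=> dj d_o; case: e' => eq; last by have := w_other d e d_o; rewrite eq eqxx.
    by have [eqd _] := inj _ _ _ _ d_o jo eq; rewrite eqd eqxx in dj.
  rewrite /g' /upd => c'j; case: (eqVneq c o) => [->|co]; case: (eqVneq c' o) => [->|c'o] e.
  + by split=> //; case: b1 b2 e (E_neq Ew) => [] [] // ->; rewrite eqxx.
  + by have := new _ _ _ c'j c'o (esym e).
  + by have := new _ _ _ cj co e.
  + exact: inj.
- apply/freeP => c b' cj; rewrite /g' /upd; case: (eqVneq c o) => [_|co]; last first.
    by apply/eqP => e; have [ec _] := inj _ _ _ _ co jo e; rewrite ec eqxx in cj.
  case: b'; last by rewrite eq_sym w_other.
  by apply/eqP => e; have [_ eb] := inj _ _ _ _ jo jo e; case: (b) eb.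
- move=> v fv vw; apply/freeP => c b' cj; rewrite /g' /upd; case: (eqVneq c o) => [_|co].
    by case: b'; rewrite ?(free_other _ fv) // eq_sym.
  exact: (free_other b' fv co).
Qed.

(** The missing colour stays [o]. Colour [j] moves to a free edge of its own, which frees both ends
    of its blob at once. *)
Lemma swap_edge g o j u v (g' := upd g j u v) :
  state g o -> j != o -> free g o u -> free g o v -> E j u v ->
  [/\ state g' o, forall b, free g' o (g j b) &
      forall x, free g o x -> x != u -> x != v -> free g' o x].
Proof.
move=> [Hg inj] jo fu fv Euv; have u_other := free_other _ fu; have v_other := free_other _ fv.
have new d e e' : d != o -> g d e <> (if e' then u else v).
  by move=> Hd eq; case: e' eq => eq; [have := u_other d e Hd | have := v_other d e Hd]; rewrite eq eqxx.
split.
- split=> [c co|c b c' b' co c'o]; rewrite /g' /upd; first by case: eqVneq => [->|_] //; apply: Hg.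
  case: (eqVneq c j) => [->|cj]; case: (eqVneq c' j) => [->|c'j] e.
  + by split=> //; case: b b' e (E_neq Euv) => [] [] // ->; rewrite eqxx.
  + by have := new _ _ _ c'o (esym e).
  + by have := new _ _ _ co e.
  + exact: inj.
- move=> b; apply/freeP => c b' co; rewrite /g' /upd; case: (eqVneq c j) => [_|cj].
    by case: b'; rewrite eq_sym ?u_other ?v_other.
  by apply/eqP => e; have [ec _] := inj _ _ _ _ co jo e; rewrite ec eqxx in cj.
- move=> x fx xu xv; apply/freeP => c b' co; rewrite /g' /upd; case: (eqVneq c j) => [_|cj].
    by case: b'; rewrite eq_sym.
  exact: (free_other b' fx co).
Qed.

Hypothesis nofull : forall g, ~ full g.

Lemma stuck g o u v : state g o -> free g o u -> free g o v -> E o u v = false.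
Proof. by move=> st fu fv; apply/negP => Euv; have := add_edge st fu fv Euv; apply: nofull. Qed.

Context (g : ends) (o : C).
Hypothesis st : state g o.

Definition W := [set v | free g o v].

(* [near D X g' i]: the state [(g', i)] arises from [(g, o)] by recolouring edges
   of colours in [D] only and using up free vertices in [X] only. *)
Definition near (D : {set C}) (X : {set V}) (g' : ends) i : Prop :=
  [/\ state g' i, o \in D, i \in D,
      forall d b, d \notin D -> g' d b = g d b &
      forall w, w \in W -> w \notin X -> free g' i w].

Lemma near0 : near [set o] set0 g o.
Proof. by split; rewrite ?inE // => w; rewrite inE. Qed.

(** The last clause keeps ends freed by earlier switches free; [near] itself only keeps track of
    vertices of [W]. *)
Lemma near_switch D X g' i j b w : near D X g' i ->
  j \notin D -> w \in W -> w \notin X -> E i (g j b) w ->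
  exists g2, [/\ near (j |: D) (w |: X) g2 j, free g2 j (g j (~~ b)) &
                 forall v, v \notin W -> free g' i v -> free g2 j v].
Proof.
move=> [st' oD iD eqg fW] jD wW wX Ew.
have ji : j != i by apply: contraNneq jD => ->.
have [|st2 fr2 fo2] := @switch_edge g' i j b w st' ji (fW _ wW wX); first by rewrite eqg.
exists (upd g' i (g' j b) w); split.
- split=> //; rewrite ?inE ?oD ?orbT ?eqxx //.
    move=> d b'; rewrite !inE negb_or => /andP [dj dD].
    by rewrite upd_other ?eqg //; apply: contraNneq dD => ->.
  by move=> x xW; rewrite !inE negb_or => /andP [xw xX]; apply: fo2 => //; apply: fW.
- by rewrite -eqg.
- by move=> v vW fv; apply: fo2 => //; apply: contraNneq vW => ->.
Qed.

Definition adj l j w := (j != o) && [exists b, E l (g j b) w].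

Lemma adjP l j w : reflect (j != o /\ exists b, E l (g j b) w) (adj l j w).
Proof. by apply: (iffP andP) => [[jo /existsP H]|[jo H]]; split=> //; apply/existsP. Qed.

Lemma card_adj_blob l w : #|[set j | adj l j w]| <= 2.
Proof.
apply: leq_trans (E_deg l w).
have [f Hf] := @ex_fin_choice C bool true (fun j => adj l j w) (fun j b => E l (g j b) w)
  (fun j aj => let: conj _ H := elimT (adjP _ _ _) aj in H).
apply: (card_inj_on (f := fun j => g j (f j))) => [j j'|j]; rewrite !inE => aj.
  by move=> aj' /(state_inj st) -[] //; [case/adjP: aj | case/adjP: aj'].
by rewrite E_sym; apply: Hf.
Qed.

Lemma card_adj_vertex l j : #|[set w | adj l j w]| <= 4.
Proof.
have sub : [set w | adj l j w] \subset [set w | E l (g j true) w] :|: [set w | E l (g j false) w].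
  by apply/subsetP => w; rewrite !inE => /adjP [_ [[]]] ->; rewrite ?orbT.
apply: leq_trans (subset_leq_card sub) _; apply: leq_trans (cardsU_leq _ _) _.
exact: leq_add (E_deg _ _) (E_deg _ _).
Qed.

Context (n : nat).
Hypothesis nE : #|C| = n.
Hypothesis Ecov : forall c, 3 * n <= #|covered (E c)| + 2.

Definition uncov c := [set p : C * bool | (p.1 != o) && (g p.1 p.2 \notin covered (E c))].

(** At most 2(n-1) - |uncov c| of the 3n-2 covered vertices are matched ends; the others lie in
    [W]. *)
Lemma covered_free c : n + #|uncov c| <= #|covered (E c) :&: W|.
Proof.
pose P := [set p : C * bool | p.1 != o].
have cardP : #|P| = 2 * (n - 1).
  have -> : P = setX [set~ o] [set: bool] by apply/setP => -[c' b]; rewrite !inE andbT.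
  by rewrite cardsX cardsC1 cardsT card_bool nE mulnC subn1.
have H : #|covered (E c) :\: W| <= #|P :\: uncov c|.
  rewrite (_ : covered (E c) :\: W = (fun p => g p.1 p.2) @: (P :\: uncov c)); first exact: leq_imset_card.
  apply/setP => v; apply/idP/imsetP.
    rewrite in_setD => /andP [vW vc]; move: vW; rewrite inE => /not_freeP [d [b [d_o e]]].
    by exists (d, b); rewrite /= ?e // in_setD [_ \in uncov c]inE [_ \in P]inE /= d_o e vc.
  case=> -[d b]; rewrite in_setD [_ \in uncov c]inE [_ \in P]inE /= => /andP [H d_o] ->.
  rewrite d_o /= negbK in H; rewrite in_setD H andbT [_ \in W]inE.
  by apply/not_freeP; exists d, b.
have sub : uncov c \subset P by apply/subsetP => p; rewrite !inE => /andP [].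
have n0 : 0 < n by rewrite -nE; apply/card_gt0P; exists o.
have := Ecov c; rewrite -(cardsID W (covered _)).
have PD : #|P :\: uncov c| = #|P| - #|uncov c| by rewrite cardsD (setIidPr sub).
have := subset_leq_card sub; move: H; rewrite PD cardP.
lia.
Qed.

Definition reached c X := [set w in W :\: X | [exists j, adj c j w]].

Lemma reached_indep D X g' c w w' : near D X g' c ->
  w \in reached c X -> w' \in reached c X -> E c w w' = false.
Proof.
move=> [st' _ _ _ fW]; rewrite ![_ \in reached _ _]inE !in_setD.
move=> /andP [/andP [wX wW] _] /andP [/andP [w'X w'W] _].
by apply: (stuck st'); apply: fW.
Qed.

(** A covered vertex of [W] that is neither in [X] nor adjacent to [X] must have its neighbour at a
    blob, since the missing colour has no edge between free vertices. [X] and its at most 2|X|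
    neighbours give the loss [3 * #|X|]. *)
Lemma card_reached D X g' c : near D X g' c -> n + #|uncov c| <= #|reached c X| + 3 * #|X|.
Proof.
move=> [st' _ _ _ fW]; apply: leq_trans (covered_free c) _.
pose nb := [set w | [exists x in X, E c x w]].
have nbX : #|nb| <= #|X| * 2 by apply: card_exists_leq => x _; apply: E_deg.
suff sub : covered (E c) :&: W \subset reached c X :|: (X :|: nb).
  apply: leq_trans (subset_leq_card sub) _; apply: leq_trans (cardsU_leq _ _) _.
  by have := cardsU_leq X nb; lia.
apply/subsetP => w; rewrite 2!in_setU !in_setI => /andP [cw wW].
case: (boolP (w \in X)) => wX; first by rewrite orbT.
move: cw; rewrite inE => /existsP [u Euw]; case: (boolP (u \in X)) => uX.
  by rewrite [w \in nb]inE orbA orbC; apply/orP; left; apply/exists_inP; exists u.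
suff : exists j, adj c j w by move=> H; rewrite inE in_setD wX wW /=; apply/orP; left; apply/existsP.
case: (boolP (u \in W)) => uW; first by rewrite (stuck st' (fW _ uW uX) (fW _ wW wX)) in Euw.
move: uW; rewrite inE => /not_freeP [j [b [jo e]]]; exists j; apply/adjP; split=> //.
by exists b; rewrite e.
Qed.

End States.

(** * Chains of switches *)

Lemma half_budget n k h v a b : v <= a + b -> a <= h -> 8 * k * h <= n -> 8 * k * b <= n ->
  4 * k * v <= n.
Proof.
move=> H1 H2; have := leq_mul (leqnn (4 * k)) H1; have := leq_mul (leqnn (4 * k)) H2; lia.
Qed.

Section Chains.
Context (C V : finType) (E : C -> rel V).
Hypothesis Ecl : forall c, clique_graph (E c).
Context (g : ends C V) (o : C).
Hypothesis st : state E g o.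
Context (n : nat).
Hypothesis nE : #|C| = n.

Local Notation W := (W g o).
Local Notation near := (near E g o).
Local Notation adj := (adj E g o).

Implicit Types (D Y : {set C}) (X Z : {set V}).

(** This bounds how many predecessors of [c] may be lost when the vertices of [Z] are forbidden. *)
Definition via c (Z : {set V}) := #|[set l | [exists w in Z, adj l c w]]|.

Lemma viaU c (Z1 Z2 : {set V}) : via c (Z1 :|: Z2) <= via c Z1 + via c Z2.
Proof.
apply: leq_trans (cardsU_leq _ _); apply: subset_leq_card; apply/subsetP => l.
rewrite !inE => /exists_inP [w]; rewrite inE => /orP [] wZ a; apply/orP; [left|right].
  by apply/exists_inP; exists w.
by apply/exists_inP; exists w.
Qed.

Lemma via_large Z m : #|[set c | m <= via c Z]| * m <= n * (#|Z| * 2).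
Proof.
rewrite -nE; apply: markov_rel => l; apply: card_exists_leq => w _.
exact: card_adj_blob.
Qed.

Context (h : nat).

Definition heavy l := [set w in W | h <= #|[set i | adj i l w]|].

Lemma heavy_card l : #|heavy l| * h <= 4 * n.
Proof.
apply: leq_trans (_ : #|[set w | h <= #|[set i | adj i l w]|]| * h <= _).
  by rewrite leq_mul2r subset_leq_card ?orbT //; apply/subsetP => w; rewrite !inE => /andP [].
rewrite mulnC -nE mulnC [4 * _]mulnC; apply: markov_rel => i; exact: card_adj_vertex.
Qed.

Lemma heavy_vertex w : #|[set l | w \in heavy l]| * h <= 2 * n.
Proof.
apply: leq_trans (_ : #|[set l | h <= #|[set i | adj i l w]|]| * h <= _).
  by rewrite leq_mul2r subset_leq_card ?orbT //; apply/subsetP => l; rewrite !inE => /andP [].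
rewrite mulnC -nE mulnC [2 * _]mulnC; apply: markov_rel => i; exact: card_adj_blob.
Qed.

Lemma via_light c (X : {set V}) : X \subset W -> [disjoint X & heavy c] -> via c X <= #|X| * h.
Proof.
move=> XW dis; apply: card_exists_leq => w wX.
have := disjointFr dis wX; rewrite inE (subsetP XW _ wX) /= => /negbT.
by rewrite -ltnNge => /ltnW.
Qed.

(** The vertex has to be light for the source [l], not for the target: a route is built backwards,
    so [l] must still be entered after [w] has been reserved. *)
Definition leads l c := [exists w, [&& w \in W, w \notin heavy l & adj l c w]].
(** The exit from [l] differs from every vertex through which [i] can enter [l], so the first two
    switches of a chain cannot collide. *)
Definition leads_avoiding i l c :=
  [exists w, [&& w \in W, w \notin heavy l, ~~ adj i l w & adj l c w]].

Lemma leads_avoiding_sub i : subrel (leads_avoiding i) leads.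
Proof.
by move=> l c /existsP [w /and4P [wW wh _ a]]; apply/existsP; exists w; rewrite wW wh a.
Qed.

(** Colour [i] joins the blob [l] to at most 4 vertices, and colour [l] joins each of them to at
    most 2 blobs. *)
Lemma leads_avoiding_loss i l : #|outn leads l :\: outn (leads_avoiding i) l| <= 8.
Proof.
have sub : outn leads l :\: outn (leads_avoiding i) l \subset
    [set c | [exists w in [set w | adj i l w], adj l c w]].
  apply/subsetP => c; rewrite !inE => /andP [/existsPn H /existsP [w /and3P [wW wh a]]].
  have := H w; rewrite wW wh a /= andbT negbK => ai.
  by apply/exists_inP; exists w; rewrite ?inE.
apply: leq_trans (subset_leq_card sub) _.
apply: leq_trans (card_exists_leq (k := 2) _) _ => [w _|]; first exact: card_adj_blob.
by rewrite -[8]/(4 * 2) leq_mul2r card_adj_vertex.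
Qed.

(** [Y] and [Z] are the colours and vertices reserved for later switches; [m] bounds the number of
    switches made. *)
Definition enlarge (D : {set C}) (X : {set V}) (Y : {set C}) (Z : {set V}) m (D2 : {set C}) (X2 : {set V}) : Prop :=
  [/\ D \subset D2, X \subset X2, D2 \subset D :|: ~: Y, X2 \subset X :|: (W :\: Z) &
      #|D2| <= #|D| + m /\ #|X2| <= #|X| + m].

Lemma enlarge_step D X Y Z m D2 X2 j w : enlarge D X Y Z m D2 X2 ->
  j \notin Y -> w \in W -> w \notin Z -> enlarge D X Y Z m.+1 (j |: D2) (w |: X2).
Proof.
move=> [DD XX DY XZ [Dm Xm]] jY wW wZ; split.
- exact: subset_trans DD (subsetUr _ _).
- exact: subset_trans XX (subsetUr _ _).
- by rewrite subUset DY andbT sub1set !inE jY orbT.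
- by rewrite subUset XZ andbT sub1set in_setU in_setD wZ wW orbT.
- by rewrite !cardsU1; move: Dm Xm; clear; split; lia.
Qed.

Lemma enlargeW D X (Y : {set C}) (Z : {set V}) m Y' Z' m' D2 X2 : Y \subset Y' -> Z \subset Z' -> m <= m' ->
  enlarge D X Y' Z' m D2 X2 -> enlarge D X Y Z m' D2 X2.
Proof.
move=> YY ZZ mm [DD XX DY XZ [Dm Xm]]; split=> //.
- by apply: subset_trans DY _; apply: setUS; rewrite setCS.
- by apply: subset_trans XZ _; apply: setUS; apply: setDS.
- by split; lia.
Qed.

Section Reachability.
Context (k f : nat) (A : {set C}).
Hypothesis k0 : 0 < k.
Hypothesis h_small : 8 * k * h <= n.
Hypothesis f_small : 4 * k * (f + 1 + 16 * k * f) < n.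

Lemma via_many (Z : {set V}) : #|Z| <= f -> #|[set l | n < 8 * k * via l Z]| <= 16 * k * f.
Proof.
move=> Zf; set m := (n %/ (8 * k)).+1.
have n_lt : n < 8 * k * m by rewrite mulnC ltn_ceil; lia.
have sub : [set l | n < 8 * k * via l Z] \subset [set l | m <= via l Z].
  by apply/subsetP => l; rewrite !inE /m ltn_divLR ?[_ * (8 * k)]mulnC //; lia.
apply: leq_trans (subset_leq_card sub) _; set s := #|_|.
have Hs : s * m <= n * (#|Z| * 2) by apply: via_large.
have n0 : 0 < n by lia.
rewrite -(@leq_pmul2r n) //; apply: leq_trans (_ : 8 * k * (s * m) <= _).
  by have := leq_mul (leqnn s) (ltnW n_lt); lia.
by have := leq_mul (leqnn (8 * k)) Hs; have := leq_mul (leqnn (16 * k * n)) Zf; lia.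
Qed.

Lemma chain_reach D X g' i t c Y Z :
  near D X g' i ->
  c \in reach n (2 * k) A leads (frontier n (2 * k) A (leads_avoiding i) (outn leads i :&: A)) t ->
  c \notin D -> c \notin Y -> 4 * k * via c (X :|: Z) <= n ->
  #|X :|: Z| + t <= f -> #|D :|: Y| + t <= f ->
  exists D2 X2 g2, [/\ near D2 X2 g2 c, enlarge D X Y Z (t + 2) D2 X2 &
    forall v, v \notin W -> free g' i v -> free g2 c v].
Proof.
(* The base case performs two switches, from [i] to [l] to [c], because the first layer is defined
   by [leads_avoiding]. *)
move=> nr; elim: t c Y Z => [|t IH] c Y Z.
  rewrite /= addn0 => cR cD cY viac Xf; rewrite addn0 => Df.
  move: cR; rewrite inE => /andP [cA many].
  pose S1 := [set l | [exists w in X :|: Z, adj l c w]].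
  pose S3 := [set l | [exists w in X :|: Z, adj i l w]].
  have S3f : #|S3| <= #|X :|: Z| * 2.
    by apply: card_exists_leq => w _; apply: card_adj_blob.
  have [l] : exists2 l, l \in [set l in outn leads i :&: A | leads_avoiding i l c] &
      l \notin S1 :|: (c |: (D :|: Y)) :|: S3.
    apply: subset_card_ltn_ex.
    apply: leq_ltn_trans (_ : via c (X :|: Z) + (f + 1 + 2 * f) < _).
      apply: leq_trans (cardsU_leq _ _) _; rewrite addnA; apply: leq_add; last by lia.
      apply: leq_trans (cardsU_leq _ _) _; rewrite leq_add2l cardsU1; lia.
    rewrite -(@ltn_pmul2l (4 * k)); last by lia.
    apply: leq_ltn_trans (_ : 4 * k * via c (X :|: Z) + 4 * k * (f + 1 + 16 * k * f) < _).
      rewrite -mulnDr leq_mul2l leq_add2l; apply/orP; right.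
      by have := leq_mul k0 (leqnn f); lia.
    by move: many; lia.
  rewrite inE in_setI => /andP [/andP [iarc lA] larc] lbad.
  move: iarc larc lbad; rewrite !inE !negb_or => /existsP [w0 /and3P [w0W _ a0]].
  case/existsP=> w /and4P [wW _ nai al] /andP [/andP [/exists_inPn lS1 /and3P [lc lD lY]] /exists_inPn lS3].
  have w0Z : w0 \notin X :|: Z by apply: contraL a0 => /lS3.
  have wZ : w \notin X :|: Z by apply: contraL al => /lS1.
  move: w0Z wZ; rewrite !inE !negb_or => /andP [w0X w0Z] /andP [wX wZ].
  have ww0 : w != w0 by apply: contraNneq nai => ->.
  have [_ [b0 Eb0]] := elimT (adjP _ _ _ _ _ _) a0; have [_ [b Eb]] := elimT (adjP _ _ _ _ _ _) al.
  have [g1 [nr1 _ fr1]] := near_switch Ecl nr lD w0W w0X Eb0.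
  have [||g2 [nr2 _ fr2]] := near_switch Ecl nr1 (j := c) _ wW _ Eb.
  - by rewrite !inE negb_or eq_sym lc.
  - by rewrite !inE negb_or ww0.
  exists (c |: (l |: D)), (w |: (w0 |: X)), g2; split=> //; last by move=> v vW fv; apply/fr2/fr1.
  apply: (enlarge_step _ cY wW wZ); apply: (enlarge_step _ lY w0W w0Z).
  by split; rewrite ?addn0 ?subsetUl.
rewrite [reach _ _ _ _ _ _]/= inE => cR cD cY viac Xf Df.
case/orP: cR => [cR|].
  have [||D2 [X2 [g2 [nr2 en2 fr2]]]] := IH c Y Z cR cD cY viac; [lia|lia|].
  by exists D2, X2, g2; split=> //; apply: enlargeW en2 => //; lia.
set R := reach _ _ _ _ _ t in IH *; rewrite inE => /andP [cA many].
pose S1 := [set l | [exists w in X :|: Z, adj l c w]].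
(* Excluding [S3] leaves [via l] at most n/(8k); the new vertex [w] adds at most [h], hence another
   n/(8k), and the budget n/(4k) is kept. Of the n/(2k) predecessors, at most n/(4k) are lost to
   [S1], and fewer than n/(4k) to the other exclusions by [f_small]. *)
pose S3 := [set l | n < 8 * k * via l (X :|: Z)].
have S3f : #|S3| <= 16 * k * f by apply: via_many; lia.
have [l] : exists2 l, l \in [set l in R | leads l c] & l \notin S1 :|: (c |: (D :|: Y)) :|: S3.
  apply: subset_card_ltn_ex.
  apply: leq_ltn_trans (_ : via c (X :|: Z) + (f + 1 + 16 * k * f) < _).
    apply: leq_trans (cardsU_leq _ _) _; rewrite addnA; apply: leq_add => //.
    apply: leq_trans (cardsU_leq _ _) _; rewrite leq_add2l cardsU1; lia.
  rewrite -(@ltn_pmul2l (4 * k)); last by lia.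
  by rewrite mulnDr; lia.
rewrite inE => /andP [lR larc] lbad.
move: larc lbad; rewrite !inE !negb_or => /existsP [w /and3P [wW wh al]].
case/andP => /andP [/exists_inPn lS1 /and3P [lc lD lY]] lvia.
have wZ : w \notin X :|: Z by apply: contraL al => /lS1.
move: wZ; rewrite inE negb_or => /andP [wX wZ].
have viaw : via l [set w] <= h.
  by rewrite -[h]mul1n -(cards1 w); apply: via_light; rewrite ?sub1set // disjoints1.
have XZ : X :|: (w |: Z) = w |: (X :|: Z) by rewrite setUCA.
have DY : D :|: (c |: Y) = c |: (D :|: Y) by rewrite setUCA.
have [||||D2 [X2 [g2 [nr2 en2 fr2]]]] := IH l (c |: Y) (w |: Z) lR lD.
- by rewrite !inE negb_or lc.
- rewrite XZ; have := viaU l [set w] (X :|: Z); rewrite -leqNgt in lvia.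
  by move=> H; apply: half_budget H viaw h_small lvia.
- by rewrite XZ cardsU1; move: Xf; clear; lia.
- by rewrite DY cardsU1; move: Df; clear; lia.
have [_ _ D2Y X2Z _] := en2.
have cD2 : c \notin D2.
  by apply/negP => /(subsetP D2Y); rewrite !inE (negbTE cD) eqxx.
have wX2 : w \notin X2.
  by apply/negP => /(subsetP X2Z); rewrite in_setU in_setD in_setU1 (negbTE wX) eqxx.
have [_ [b Eb]] := elimT (adjP _ _ _ _ _ _) al.
have [g3 [nr3 _ fr3]] := near_switch Ecl nr2 cD2 wW wX2 Eb.
exists (c |: D2), (w |: X2), g3; split=> //; last by move=> v vW fv; apply/fr3/fr2.
rewrite addSn; apply: (enlarge_step _ cY wW wZ).
by apply: enlargeW en2; rewrite ?subsetUr.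
Qed.

End Reachability.
End Chains.

(** * The core of the colours *)

Definition holds (P : Prop) : bool := if excluded_middle_informative P then true else false.

Lemma holdsP P : reflect P (holds P).
Proof. by rewrite /holds; case: excluded_middle_informative => H; constructor. Qed.

Lemma card_pairs (C : finType) (I : {set C * bool}) :
  #|I| = #|[set j | ((j, true) \in I) || ((j, false) \in I)]| +
         #|[set j | ((j, true) \in I) && ((j, false) \in I)]|.
Proof.
pose S b := [set j | (j, b) \in I].
have SI b : #|S b| = #|[set p in I | p.2 == b]|.
  rewrite -(card_imset _ (f := fun j => (j, b))) => [|j j' [] //].
  apply: eq_card => -[j b']; rewrite inE /=; apply/imsetP/andP => [[j' + [-> ->]]|[jI /eqP <-]].
    by rewrite inE => ->.
  by exists j; rewrite ?inE.
have -> : #|I| = #|S true| + #|S false|.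
  rewrite !SI -(cardsID [set p | p.2 == true] I); congr (_ + _); apply: eq_card => p; rewrite !inE //.
  by rewrite andbC; case: p.2.
by rewrite -cardsUI; congr (_ + _); apply: eq_card => j; rewrite !inE.
Qed.

Section Hub.
Context (C V : finType) (E : C -> rel V).
Hypothesis Ecl : forall c, clique_graph (E c).
Hypothesis nofull : forall g, ~ full E g.
Context (g : ends C V) (o : C).
Hypothesis st : state E g o.
Context (n : nat).
Hypothesis nE : #|C| = n.
Hypothesis Ecov : forall c, 3 * n <= #|covered (E c)| + 2.
Context (h K : nat).
Hypothesis h0 : 0 < h.
Hypothesis hK : 4 * n <= K * h.

Local Notation W := (W g o).
Local Notation near := (near E g o).
Local Notation adj := (adj E g o).
Local Notation heavy := (heavy E g o h).
Local Notation leads := (leads E g o h).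

Lemma heavy_leq c : #|heavy c| <= K.
Proof. by rewrite -(@leq_pmul2r h) //; apply: leq_trans (heavy_card Ecl g o nE h c) hK. Qed.

Lemma heavy_at_leq w : #|[set l | w \in heavy l]| <= K.
Proof.
rewrite -(@leq_pmul2r h) //; apply: leq_trans (heavy_vertex Ecl st nE h w) _.
by apply: leq_trans hK; rewrite leq_mul2r orbT.
Qed.

Definition legit t c := exists D X g', [/\ near D X g' c, #|D| <= t.+1 & #|X| <= t].

Lemma legit_base t c : c \in outn leads o -> legit t.+1 c.
Proof.
rewrite inE => /existsP [w /and3P [wW _ /adjP [co [b Eb]]]].
have [||g' [nr _ _]] := near_switch Ecl (near0 st) (j := c) _ wW _ Eb; rewrite ?inE //.
exists (c |: [set o]), (w |: set0), g'; split=> //.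
  by rewrite cards2 co.
by rewrite setU0 cards1.
Qed.

(** A switch fails only if its blob lies in [D] or its vertex in [X]; these account for at most
    (t+1) + 2t blobs. *)
Lemma legit_arcs t c : legit t c ->
  exists S : {set C}, #|S| <= 3 * t + 1 /\ forall j, leads c j -> j \in S \/ legit t.+1 j.
Proof.
move=> [D [X [g' [nr Dt Xt]]]]; exists (D :|: [set j | [exists w in X, adj c j w]]).
split.
  apply: leq_trans (cardsU_leq _ _) _.
  have : #|[set j | [exists w in X, adj c j w]]| <= #|X| * 2.
    by apply: card_exists_leq => w _; apply: card_adj_blob.
  lia.
move=> j /existsP [w /and3P [wW _ aj]]; rewrite !inE.
case: (boolP (j \in D)) => jD; first by left.
case: (boolP (w \in X)) => wX; first by left; apply/orP; right; apply/exists_inP; exists w.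
have [_ [b Eb]] := elimT (adjP _ _ _ _ _ _) aj.
have [g2 [nr2 _ _]] := near_switch Ecl nr jD wW wX Eb.
right; exists (j |: D), (w |: X), g2; split=> //; rewrite cardsU1.
  by move: Dt; case: (_ \notin _); lia.
by move: Xt; case: (_ \notin _); lia.
Qed.

Definition light (X0 : {set V}) c w := [&& w \in W, w \notin X0 & w \notin heavy c].

(** Two vertices attached to the same end would be joined in colour [c] by transitivity, but [c] has
    no edge among the vertices it reaches. So any choice of ends is injective. *)
Lemma legit_exits t c (X0 : {set V}) : legit t c -> exists S : {set V},
  [/\ n + #|uncov E g o c| <= #|S| + 3 * t + K + #|X0|,
      forall w, w \in S -> light X0 c w &
      exists phi : V -> C * bool, {in S &, injective phi} /\
        forall w, w \in S -> (phi w).1 != o /\ E c (g (phi w).1 (phi w).2) w].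
Proof.
move=> [D [X [g' [nr _ Xt]]]]; exists (reached E g o c X :\: (heavy c :|: X0)); split.
- have := card_reached Ecl nofull nE Ecov nr.
  have H : #|reached E g o c X| <= #|reached E g o c X :\: (heavy c :|: X0)| + (K + #|X0|).
    rewrite -(cardsID (heavy c :|: X0) (reached _ _ _ _ _)) addnC leq_add2l.
    apply: leq_trans (subset_leq_card (subsetIr _ _)) _; apply: leq_trans (cardsU_leq _ _) _.
    by rewrite leq_add2r heavy_leq.
  by move: H Xt; clear; lia.
- move=> w; rewrite in_setD in_setU negb_or => /andP [/andP [wh wX]].
  by rewrite inE in_setD /light wh wX => /andP [/andP [_ ->] _].
set S := _ :\: _.
have [|phi Hphi] := @ex_fin_choice V (C * bool)%type (o, true) (fun w => w \in S)
   (fun w p => p.1 != o /\ E c (g p.1 p.2) w).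
  move=> w; rewrite in_setD => /andP [_].
  rewrite inE => /andP [_ /existsP [j /adjP [jo [b Eb]]]].
  by exists (j, b).
exists phi; split=> // w w' wS w'S e; apply/eqP; apply: contraT => ww'.
have [_ E1] := Hphi _ wS; have [_ E2] := Hphi _ w'S.
have : E c w w' by apply: (E_trans Ecl _ E2 ww'); rewrite -e (E_sym Ecl).
by move: wS w'S; rewrite !in_setD => /andP [_ wR] /andP [_ w'R];
  rewrite (reached_indep Ecl nofull nr wR w'R).
Qed.

Definition doubled X0 c j := (j != o) && [exists w, exists w',
  [&& w != w', light X0 c w, light X0 c w', E c (g j true) w & E c (g j false) w']].

(** The image of [phi] is counted by blobs: a blob contributes a second end only if it is
    doubled. *)
Lemma exits_leq X0 c (S : {set V}) (phi : V -> C * bool) :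
  {in S &, injective phi} ->
  (forall w, w \in S -> light X0 c w /\ ((phi w).1 != o /\ E c (g (phi w).1 (phi w).2) w)) ->
  #|S| <= #|outn leads c :&: [set (phi w).1 | w in S]| + #|[set j | doubled X0 c j]|.
Proof.
move=> inj HS; rewrite -(card_in_imset inj) (card_pairs (phi @: S)).
apply: leq_add; apply: subset_leq_card; apply/subsetP => j; rewrite inE.
  have H b : (j, b) \in phi @: S -> j \in outn leads c :&: [set (phi w).1 | w in S].
    case/imsetP=> w wS e; rewrite in_setI; apply/andP; split; last by apply/imsetP; exists w; rewrite -?e.
    have [/and3P [wW _ wh] [jo Ew]] := HS _ wS; rewrite inE; apply/existsP; exists w; rewrite wW wh /=.
    by apply/adjP; split; [move: jo; rewrite -e | exists b; move: Ew; rewrite -e].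
  by case/orP; apply: H.
case/andP => /imsetP [w wS e] /imsetP [w' w'S e'].
have [lw [jo Ew]] := HS _ wS; have [lw' [_ Ew']] := HS _ w'S.
rewrite inE /doubled; apply/andP; split; first by move: jo; rewrite -e.
apply/existsP; exists w; apply/existsP; exists w'; rewrite lw lw' /=.
move: Ew Ew'; rewrite -e -e' /= => -> ->; rewrite ?andbT.
by apply/eqP => ww; move: e; rewrite ww -e'.
Qed.

(** A blob has two ends, so nearly n exits meet at least about n/2 blobs. *)
Lemma legit_outdeg t c : legit t c -> n <= 2 * #|outn leads c| + 3 * t + K.
Proof.
move=> /(legit_exits set0) [S [big HS [phi [inj Hphi]]]].
have : #|S| <= #|setX (outn leads c) [set: bool]|.
  apply: (card_inj_on inj) => w wS; rewrite [phi w]surjective_pairing in_setX in_setT andbT inE.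
  have /and3P [wW _ wh] := HS _ wS; have [jo Ew] := Hphi _ wS.
  apply/existsP; exists w; rewrite wW wh; apply/adjP; split=> //; by exists (phi w).2.
by rewrite cardsX cardsT card_bool; move: big; rewrite cards0; clear; lia.
Qed.

Context (k : nat).
Hypothesis k_large : 1000 <= k.
Hypothesis n_large : 100 * (3 * (2 * k + 1) + K) + 2 * k * (6 * k + 4) <= n.

(** Arcs from the colours reached in [t] steps end, up to bounded exceptions, at colours reached in
    [t+1] steps. At a step of slow growth few arcs therefore leave, and this set is the [L] from
    which the core is cut. *)
Lemma hub_exists : exists A : {set C},
  [/\ forall c, c \in A -> legit (2 * k + 1) c, n <= 4 * #|A|,
      k * arcs leads A (~: A) <= 2 * (n * n),
      k * #|A :\: [set i in A | n <= 4 * #|outn leads i :&: A|]| <= 10 * n &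
      forall i, n <= 8 * #|outn leads i :&: A| ->
        reach n (2 * k) A leads
          (frontier n (2 * k) A (leads_avoiding E g o h i) (outn leads i :&: A)) (4 * k * k) = A].
Proof.
pose F t := [set c | holds (legit t.+1 c)].
have Fmono t : F t \subset F t.+1.
  apply/subsetP => c; rewrite !inE => /holdsP [D [X [g' [nr Dt Xt]]]]; apply/holdsP.
  by exists D, X, g'; split=> //; lia.
have [|t tk Ft] := @slow_growth C F (2 * k) _ Fmono; first by lia.
rewrite nE in Ft.
have Fdeg l : l \in F t -> 9 * n <= 20 * #|outn leads l|.
  rewrite inE => /holdsP /legit_outdeg.
  by move: tk n_large; clear; lia.
have Fbig : n <= 50 * #|F t|.
  have sub : outn leads o \subset F t.
    apply: subset_trans (_ : F 0 \subset _).
      by apply/subsetP => c /(legit_base 0) H; rewrite inE; apply/holdsP.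
    by elim: (t) => // m; move/subset_trans; apply.
  have : legit 0 o by exists [set o], set0, g; rewrite cards1 cards0; split=> //; apply: near0.
  move/legit_outdeg; have := subset_leq_card sub; move: n_large; clear; lia.
have Fclosed : k * arcs leads (F t) (~: F t) <= n * n.
  have H : arcs leads (F t) (~: F t) <= #|F t| * (#|F t.+1 :\: F t| + (3 * t.+1 + 1)).
    apply: sum_in_leq_const => l; rewrite inE => /holdsP /legit_arcs [S [St HS]].
    apply: leq_trans (_ : #|(F t.+1 :\: F t) :|: S| <= _); last first.
      by apply: leq_trans (cardsU_leq _ _) _; rewrite leq_add2l.
    apply: subset_leq_card; apply/subsetP => j; rewrite in_setI in_setC in_setU in_setD => /andP [+ ->].
    by rewrite inE => /HS [->|H]; rewrite ?orbT // inE; apply/orP; left; apply/holdsP.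
  apply: leq_trans (leq_mul (leqnn k) H) _.
  rewrite mulnCA; apply: leq_mul; first exact: card_leq_n.
  have : k * (3 * t.+1 + 1) <= k * (6 * k + 4) by rewrite leq_mul2l; apply/orP; right; lia.
  by move: Ft n_large; clear; lia.
have [|A [AF Abig Aclosed Atyp Areach]] := core_exists nE Fbig k_large _ Fdeg Fclosed.
  by move: n_large k_large; clear; nia.
exists A; split=> //.
  move=> c /(subsetP AF); rewrite inE => /holdsP [D [X [g' [nr Dt Xt]]]].
  by exists D, X, g'; split=> //; lia.
move=> i ibig; apply: Areach => //.
- exact: leads_avoiding_sub.
- by move=> l; apply: leads_avoiding_loss.
- exact: subsetIr.
Qed.

End Hub.

(** * Switching prescribed edges *)

Lemma budget n k v x y z : v <= x + y + z ->
  32 * k * x <= n -> 32 * k * y <= n -> 32 * k * z <= n -> 4 * k * v <= n.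
Proof. by move=> H; have := leq_mul (leqnn (4 * k)) H; lia. Qed.

Section Switching.
Context (C V : finType) (E : C -> rel V).
Hypothesis Ecl : forall c, clique_graph (E c).
Hypothesis nofull : forall g, ~ full E g.
Context (g : ends C V) (o : C).
Hypothesis st : state E g o.
Context (n : nat).
Hypothesis nE : #|C| = n.
Context (h K k T f d : nat).
Hypothesis h0 : 0 < h.
Hypothesis hK : 4 * n <= K * h.
Hypothesis k0 : 0 < k.
Hypothesis TE : T = 4 * k * k + 2.
Hypothesis h_small : 96 * k * (T + 2) * h <= n.
Hypothesis f_large : d + 2 * K + 3 * (T + 2) + 10 <= f.
Hypothesis f_small : 4 * k * (f + 1 + 16 * k * f) < n.

Local Notation W := (W g o).
Local Notation near := (near E g o).
Local Notation adj := (adj E g o).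
Local Notation heavy := (heavy E g o h).
Local Notation leads := (leads E g o h).
Local Notation via := (via E g o).
Local Notation enlarge := (enlarge g o).
Local Notation light := (light E g o h).
Implicit Types (D Y : {set C}) (X Z : {set V}).

Let heavyK c : #|heavy c| <= K. Proof. exact: (heavy_leq Ecl g o nE h0 hK c). Qed.

Context (A : {set C}).
Definition open_colour i := n <= 8 * #|outn leads i :&: A|.
Hypothesis A_reach : forall i, open_colour i ->
  reach n (2 * k) A leads
    (frontier n (2 * k) A (leads_avoiding E g o h i) (outn leads i :&: A)) (4 * k * k) = A.

Lemma route D X g' i c Y Z : near D X g' i -> open_colour i -> c \in A ->
  c \notin D -> c \notin Y -> 4 * k * via c (X :|: Z) <= n ->
  #|X| + #|Z| + T <= f -> #|D| + #|Y| + T <= f ->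
  exists D2 X2 g2, [/\ near D2 X2 g2 c, enlarge D X Y Z T D2 X2 &
    forall v, v \notin W -> free g' i v -> free g2 c v].
Proof.
move=> nr ibig cA cD cY viac Xf Df.
have h8 : 8 * k * h <= n.
  by apply: leq_trans h_small; rewrite leq_mul2r; apply/orP; right; lia.
have cR := cA; rewrite -{1}(A_reach ibig) in cR.
have XZ := cardsU_leq X Z; have DY := cardsU_leq D Y.
have [||D2 [X2 [g2 [nr2 en2 fr2]]]] :=
  chain_reach Ecl st nE k0 h8 f_small nr cR cD cY viac.
- by move: XZ Xf TE; clear; lia.
- by move: DY Df TE; clear; lia.
by exists D2, X2, g2; split=> //; rewrite TE.
Qed.

(** A route to [c] that keeps [j] and [w] in reserve, followed by the prescribed edge. *)
Lemma visit D X g' i c j b w Y Z : near D X g' i -> open_colour i -> c \in A ->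
  c \notin D -> c \notin Y -> c != j -> j \notin D -> j \notin Y ->
  w \in W -> w \notin X -> w \notin Z -> E c (g j b) w ->
  4 * k * via c (w |: (X :|: Z)) <= n ->
  #|X| + #|Z| + 1 + T <= f -> #|D| + #|Y| + 1 + T <= f ->
  exists D2 X2 g2, [/\ near D2 X2 g2 j, enlarge D X Y Z T.+1 D2 X2,
    free g2 j (g j (~~ b)) &
    forall v, v \notin W -> free g' i v -> free g2 j v].
Proof.
move=> nr ibig cA cD cY cj jD jY wW wX wZ Ew viac Xf Df.
have [||||D2 [X2 [g2 [nr2 en2 fr2]]]] :=
  route (Y := j |: Y) (Z := w |: Z) nr ibig cA cD.
- by rewrite !inE negb_or cj.
- by rewrite setUCA.
- by rewrite cardsU1; move: Xf; clear; lia.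
- by rewrite cardsU1; move: Df; clear; lia.
have [_ _ D2Y X2Z _] := en2.
have jD2 : j \notin D2 by apply/negP => /(subsetP D2Y); rewrite !inE (negbTE jD) eqxx.
have wX2 : w \notin X2.
  by apply/negP => /(subsetP X2Z); rewrite in_setU in_setD in_setU1 (negbTE wX) eqxx.
have [g3 [nr3 fj fr3]] := near_switch Ecl nr2 jD2 wW wX2 Ew.
exists (j |: D2), (w |: X2), g3; split=> //; last by move=> v vW fv; apply/fr3/fr2.
by apply: enlarge_step jY wW wZ; apply: enlargeW en2; rewrite ?subsetUr.
Qed.

Context (D0 : {set C}) (X0 : {set V}) (g0 : ends C V) (a : C).
Hypothesis nr0 : near D0 X0 g0 a.
Hypothesis a_open : open_colour a.
Hypothesis D0d : #|D0| <= d.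
Hypothesis X0d : #|X0| <= d.

(** Colours that remain easy to enter although the starting state has already used [D0] and [X0]. *)
Definition calm c := [&& c \in A, c \notin D0 & 32 * k * via c X0 <= n].
(** A route to [c] can then afford to avoid all vertices heavy for [c'], which keeps [c'] easy to
    enter afterwards. *)
Definition indep c c' := 32 * k * via c (heavy c') <= n.
Definition usable j := (j \notin D0) && (n <= 8 * #|outn leads j :&: A|).

(** Every vertex used since the start is light for [c] and so spoils at most [h] predecessors. *)
Lemma via_path c X m : X0 \subset X -> X \subset X0 :|: (W :\: heavy c) ->
  #|X| <= #|X0| + m -> via c X <= via c X0 + m * h.
Proof.
move=> X0X XX Xm; rewrite -(setID X X0) (setIidPr X0X).
apply: leq_trans (viaU _ _ _ _ _ _) _; rewrite leq_add2l.
apply: leq_trans (_ : #|X :\: X0| * h <= _).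
  have sub : X :\: X0 \subset W :\: heavy c by rewrite subDset.
  apply: via_light; first exact: subset_trans sub (subsetDl _ _).
  rewrite disjoint_subset; apply/subsetP => w /(subsetP sub).
  by rewrite in_setD => /andP [].
by rewrite leq_mul2r cardsD (setIidPr X0X) leq_subLR Xm orbT.
Qed.

Lemma via_light1 c w : light X0 c w -> via c [set w] <= h.
Proof.
by case/and3P=> wW _ wh; rewrite -[h]mul1n -(cards1 w); apply: via_light;
  rewrite ?sub1set // disjoints1.
Qed.

Lemma short_light m : m <= 3 * (T + 2) -> 32 * k * (m * h) <= n.
Proof.
move=> Hm; apply: leq_trans h_small.
have -> : 96 * k * (T + 2) * h = 32 * k * (3 * (T + 2) * h) by clear; lia.
by rewrite leq_mul2l leq_mul2r Hm !orbT.
Qed.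

Lemma calm_visit_budget c c' w w' : calm c -> indep c c' -> light X0 c w -> light X0 c w' ->
  4 * k * via c (w |: (X0 :|: (w' |: heavy c'))) <= n.
Proof.
move=> /and3P [_ _ cX0] cc' lw lw'.
apply: (@budget _ _ _ (via c X0) (via c (heavy c')) (2 * h)) => //; last first.
  by apply: short_light; clear; lia.
have := viaU E g o c [set w] (X0 :|: (w' |: heavy c')).
have := viaU E g o c X0 (w' |: heavy c').
have := viaU E g o c [set w'] (heavy c').
have := via_light1 lw; have := via_light1 lw'; clear; lia.
Qed.

(* Route to [c1], switch the blob [j] with it, route on to [c2]: the end [g j (~~ b)]
   is now free, so that its edge of colour [c2] to [w2] would extend the matching. *)
Lemma pair_switch j b c1 c2 w1 w2 : usable j -> calm c1 -> calm c2 ->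
  c1 != c2 -> c1 != j -> c2 != j -> indep c1 c2 ->
  light X0 c1 w1 -> light X0 c2 w1 -> light X0 c1 w2 -> light X0 c2 w2 ->
  E c1 (g j b) w1 -> E c2 (g j (~~ b)) w2 -> w1 = w2.
Proof.
move=> /andP [jD0 jbig] calm1 calm2 c12 c1j c2j ind l11 l21 l12 l22 E1 E2.
apply/eqP; apply: contraT => w12.
have [c1A c1D0 _] := and3P calm1; have [c2A c2D0 c2X0] := and3P calm2.
have [w1W w1X0 w1h] := and3P l21; have [w2W w2X0 w2h] := and3P l22.
(* The first route reserves [w2] and avoids the vertices heavy for [c2], so that [c2] can still be
   entered by the second one. *)
have [||||||D2 [X2 [g2 [nr2 en2 fj _]]]] :=
  visit (Y := [set c2]) (Z := w2 |: heavy c2) nr0 a_open c1A c1D0 _ c1j jD0 _ w1W w1X0 _ E1.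
- by rewrite inE.
- by rewrite inE eq_sym.
- by rewrite in_setU1 negb_or w12.
- exact: calm_visit_budget.
- by rewrite cardsU1 w2h; have := heavyK c2; move: X0d f_large; clear; lia.
- by rewrite cards1; move: D0d f_large; clear; lia.
have [DD XX D2Y X2Z [D2le X2le]] := en2.
have c2D2 : c2 \notin D2 by apply/negP => /(subsetP D2Y); rewrite !inE (negbTE c2D0) eqxx.
have w2X2 : w2 \notin X2.
  by apply/negP => /(subsetP X2Z); rewrite in_setU in_setD in_setU1 (negbTE w2X0) eqxx.
have X2h : X2 \subset X0 :|: (W :\: heavy c2).
  by apply: subset_trans X2Z _; apply: setUS; apply: setDS; apply: subsetUr.
have [||||D3 [X3 [g3 [nr3 en3 fr3]]]] :=
  route (Y := set0) (Z := [set w2]) nr2 jbig c2A c2D2.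
- by rewrite inE.
- apply: (@budget _ _ _ (via c2 X0) (T.+1 * h) h) => //.
  + apply: leq_trans (viaU _ _ _ _ _ _) _; apply: leq_add; last exact: via_light1.
    exact: via_path.
  + by apply: short_light; clear; lia.
  + by rewrite -[h]mul1n; apply: short_light; clear; lia.
- by rewrite cards1; move: X2le X0d f_large; clear; lia.
- by rewrite cards0; move: D2le D0d f_large; clear; lia.
have [_ _ _ X3Z _] := en3.
have w2X3 : w2 \notin X3.
  by apply/negP => /(subsetP X3Z); rewrite in_setU in_setD in_set1 (negbTE w2X2) eqxx.
have [st3 oD3 c2D3 _ fW3] := nr3.
have fv : free g3 c2 (g j (~~ b)).
  apply: fr3 fj; rewrite inE; apply/not_freeP; exists j, (~~ b); split=> //.
  by apply: contraNneq jD0 => ->; case: nr0.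
by rewrite (stuck Ecl nofull st3 fv (fW3 _ w2W w2X3)) in E2.
Qed.

(** If [w1] and [w2] differed, [c1] could switch the blob [j] and then [c2] the blob [l], freeing
    one end of each. Once [c] is made missing, its edge between these two ends would extend the
    matching. *)
Lemma free_two j b l b' c c1 c2 w1 w2 : usable j -> usable l -> j != l ->
  calm c -> calm c1 -> calm c2 -> c1 != c2 -> c1 != c -> c2 != c ->
  c1 != j -> c2 != j -> c != j -> c1 != l -> c2 != l -> c != l ->
  indep c1 c -> indep c1 c2 -> indep c2 c ->
  light X0 c1 w1 -> light X0 c2 w1 -> light X0 c w1 -> light X0 c1 w2 -> light X0 c2 w2 -> light X0 c w2 ->
  E c1 (g j b) w1 -> E c2 (g l b') w2 -> E c (g j (~~ b)) (g l (~~ b')) -> w1 = w2.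
Proof.
move=> /andP [jD0 jbig] /andP [lD0 lbig] jl calm0 calm1 calm2 c12 c10 c20 c1j c2j c0j c1l c2l c0l.
move=> ind10 ind12 ind20 l11 l21 l01 l12 l22 l02 E1 E2 E0.
apply/eqP; apply: contraT => w12.
have [c0A c0D0 c0X0] := and3P calm0; have [c1A c1D0 c1X0] := and3P calm1.
have [c2A c2D0 c2X0] := and3P calm2.
have [w1W w1X0 w1h0] := and3P l01; have [w2W w2X0 w2h0] := and3P l02.
have [_ _ w1h2] := and3P l21; have [_ _ w2h2] := and3P l22.
pose Z1 := w2 |: (heavy c2 :|: heavy c).
have Z1K : #|Z1| <= 1 + 2 * K.
  rewrite /Z1; apply: leq_trans (cardsU_leq _ _) _; rewrite cards1 leq_add2l.
  by apply: leq_trans (cardsU_leq _ _) _; have := heavyK c; have := heavyK c2; clear; lia.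
have [||||||D2 [X2 [g2 [nr2 en2 fj _]]]] :=
  visit (Y := [set c2; l; c]) (Z := Z1) nr0 a_open c1A c1D0 _ c1j jD0 _ w1W w1X0 _ E1.
- by rewrite !inE (negbTE c12) (negbTE c1l) (negbTE c10).
- by rewrite !inE ![j == _]eq_sym (negbTE c2j) (negbTE c0j) eq_sym (negbTE jl).
- by rewrite !in_setU in_set1 (negbTE w12) (negbTE w1h2) (negbTE w1h0).
(* Five terms of size at most n/(32k) still fit into n/(4k). *)
- have cons (v x y z1 z2 : nat) : v <= x + y + z1 + 2 * z2 -> 32 * k * x <= n -> 32 * k * y <= n ->
      32 * k * z1 <= n -> 32 * k * z2 <= n -> 4 * k * v <= n.
    by move=> H; have := leq_mul (leqnn (4 * k)) H; clear; lia.
  apply: (@cons _ (via c1 X0) (via c1 (heavy c2)) (via c1 (heavy c)) h) => //; last first.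
    by rewrite -[h]mul1n; apply: short_light; clear; lia.
  have := viaU E g o c1 [set w1] (X0 :|: Z1).
  have := viaU E g o c1 X0 Z1.
  have := viaU E g o c1 [set w2] (heavy c2 :|: heavy c).
  have := viaU E g o c1 (heavy c2) (heavy c).
  have := via_light1 l11; have := via_light1 l12; rewrite -/Z1; clear; lia.
- by move: Z1K X0d f_large; clear; lia.
- have := cardsU_leq [set c2; l] [set c]; rewrite cards1 cards2.
  by case: (c2 != l) D0d f_large; clear; lia.
have [DD2 XX2 D2Y X2Z [D2le X2le]] := en2.
have c2D2 : c2 \notin D2 by apply/negP => /(subsetP D2Y); rewrite !inE (negbTE c2D0) eqxx.
have c0D2 : c \notin D2 by apply/negP => /(subsetP D2Y); rewrite !inE (negbTE c0D0) eqxx !orbT.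
have lD2 : l \notin D2 by apply/negP => /(subsetP D2Y); rewrite !inE (negbTE lD0) eqxx !orbT.
have w2X2 : w2 \notin X2.
  by apply/negP => /(subsetP X2Z); rewrite in_setU in_setD in_setU1 (negbTE w2X0) eqxx.
have X2h c' : c' \in [set c2; c] -> X2 \subset X0 :|: (W :\: heavy c').
  move=> Hc; apply: subset_trans X2Z _; apply: setUS; apply: setDS.
  by apply: subset_trans (subsetUr _ _); case/set2P: Hc => ->; rewrite ?subsetUl ?subsetUr.
have [||||||D3 [X3 [g3 [nr3 en3 fl fr3]]]] :=
  visit (Y := [set c]) (Z := heavy c) nr2 jbig c2A c2D2 _ c2l lD2 _ w2W w2X2 _ E2.
- by rewrite inE.
- by rewrite inE eq_sym.
- by [].
- apply: (@budget _ _ _ (via c2 X0) (via c2 (heavy c)) (T.+2 * h)) => //; last first.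
    by apply: short_light; clear; lia.
  have := viaU E g o c2 [set w2] (X2 :|: heavy c).
  have := viaU E g o c2 X2 (heavy c).
  have := via_light1 l22.
  have : via c2 X2 <= via c2 X0 + T.+1 * h by apply: via_path => //; apply: X2h; rewrite !inE eqxx.
  by rewrite !mulSn; clear; lia.
- by have := heavyK c; move: X2le X0d f_large; clear; lia.
- by rewrite cards1; move: D2le D0d f_large; clear; lia.
have [DD3 XX3 D3Y X3Z [D3le X3le]] := en3.
have c0D3 : c \notin D3 by apply/negP => /(subsetP D3Y); rewrite !inE (negbTE c0D2) eqxx.
have [||||D4 [X4 [g4 [nr4 en4 fr4]]]] :=
  route (Y := set0) (Z := set0) nr3 lbig c0A c0D3.
- by rewrite inE.
- rewrite setU0; apply: (@budget _ _ _ (via c X0) (T.+1 * h) (T.+1 * h)) => //.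
  + rewrite -addnA -mulnDl; apply: via_path.
    * exact: subset_trans XX2 XX3.
    * apply: subset_trans X3Z _; rewrite subUset subsetUr andbT.
      by apply: X2h; rewrite !inE eqxx orbT.
    * by move: X2le X3le; clear; lia.
  + by apply: short_light; clear; lia.
  + by apply: short_light; clear; lia.
- by rewrite cards0; move: X3le X2le X0d f_large; clear; lia.
- by rewrite cards0; move: D3le D2le D0d f_large; clear; lia.
have [st4 _ _ _ _] := nr4.
have oD0 : o \in D0 by case: nr0.
have inU i b0 : i \notin D0 -> g i b0 \notin W.
  move=> iD0; rewrite inE; apply/not_freeP; exists i, b0; split=> //.
  by apply: contraNneq iD0 => ->.
have fvj : free g4 c (g j (~~ b)) by apply/fr4/fr3 => //; apply: inU.
have fvl : free g4 c (g l (~~ b')) by apply/fr4 => //; apply: inU.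
by rewrite (stuck Ecl nofull st4 fvj fvl) in E0.
Qed.

End Switching.

(** * Regular blobs *)

Section CommonLabel.
Context (C V : finType) (F1 F2 : {set C}) (f1 f2 : C -> V) (B : rel C) (Q t : nat).
Hypothesis BQ : forall x, #|[set y | B x y]| <= Q.

Let clashing := \sum_(c1 in F1) #|[set c2 in F2 | B c1 c2 || B c2 c1]|.

Lemma clashing_leq : clashing <= Q * (#|F1| + #|F2|).
Proof.
apply: leq_trans (_ : \sum_(c1 in F1) (#|[set c2 | B c1 c2]| + #|[set c2 in F2 | B c2 c1]|) <= _).
  apply: leq_sum => c _; apply: leq_trans (cardsU_leq _ _); apply: subset_leq_card.
  by apply/subsetP => x; rewrite !inE => /andP [->].
rewrite big_split mulnDr /=; apply: leq_add.
  by rewrite mulnC; apply: sum_in_leq_const => c _.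
rewrite -(arcs_swap (fun c2 c1 => B c2 c1)) mulnC; apply: sum_in_leq_const => c _.
apply: leq_trans (BQ c); apply: subset_leq_card; apply/subsetP => x.
by rewrite !inE => /andP [].
Qed.

Lemma clashing_few1 : clashing <= t * #|F1| -> 0 < #|F1| ->
  exists2 c1, c1 \in F1 & #|[set c2 in F2 | B c1 c2 || B c2 c1]| <= t.
Proof.
move=> H F10; apply/exists_inP; apply: contraLR H; rewrite -ltnNge => /exists_inPn H.
apply: leq_trans (_ : t.+1 * #|F1| <= _); first by rewrite mulSn; lia.
rewrite mulnC; apply: sum_in_geq_const => c /H; by rewrite -ltnNge.
Qed.
End CommonLabel.

(* Every element clashes with few others, so the labels are almost constant. *)
Lemma common_label (C V : finType) (F1 F2 : {set C}) (f1 f2 : C -> V) (B : rel C) Q t :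
  (forall x, #|[set y | B x y]| <= Q) ->
  (forall c1 c2, c1 \in F1 -> c2 \in F2 -> ~~ B c1 c2 -> ~~ B c2 c1 -> f1 c1 = f2 c2) ->
  Q * (#|F1| + #|F2|) <= t * #|F1| -> Q * (#|F1| + #|F2|) <= t * #|F2| ->
  4 * t < #|F1| -> 4 * t < #|F2| ->
  exists w, #|[set c in F1 | f1 c != w]| <= t /\ #|[set c in F2 | f2 c != w]| <= t.
Proof.
move=> BQ eqf Q1 Q2 F1t F2t.
have cl12 := clashing_leq F1 F2 BQ; have cl21 := clashing_leq F2 F1 BQ.
(* By averaging there is a [c1] clashing with at most [t] elements of [F2]; its label is then the
   label of all other elements of [F2]. Likewise for [c2] and [F1]. *)
have [|| c1 c1F Hc1] := @clashing_few1 _ F1 F2 B t; [exact: leq_trans Q1 | lia |].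
have [|| c2 c2F Hc2] := @clashing_few1 _ F2 F1 B t.
  by apply: leq_trans Q2; rewrite addnC. 
  by lia.
have H2 : #|[set c in F2 | f2 c != f1 c1]| <= t.
  apply: leq_trans Hc1; apply: subset_leq_card; apply/subsetP => c; rewrite !inE => /andP [cF].
  rewrite cF /=; apply: contraR; rewrite negb_or => /andP [b1 b2].
  by rewrite (eqf c1 c).
have H1 : #|[set c in F1 | f1 c != f2 c2]| <= t.
  apply: leq_trans Hc2; apply: subset_leq_card; apply/subsetP => c; rewrite !inE => /andP [cF].
  rewrite cF /=; apply: contraR; rewrite negb_or => /andP [b1 b2].
  by rewrite (eqf c c2).
case: (eqVneq (f2 c2) (f1 c1)) => [e|ne]; first by exists (f2 c2); split=> //; rewrite e.
have cardF (F : {set C}) (P : pred C) : #|F| <= #|[set c in F | P c]| + #|[set c in F | ~~ P c]|.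
  apply: leq_trans (cardsU_leq _ _); apply: subset_leq_card; apply/subsetP => x xF.
  by rewrite !inE xF; case: (P x).
have G1 := cardF F1 (fun c => f1 c == f2 c2); have G2 := cardF F2 (fun c => f2 c == f1 c1).
(* If the two labels differed, every pair carrying them would clash. That is at least 3|F1|/4 times
   more than 3t pairs, against a total of at most t|F1|. *)
have all : #|[set c in F1 | f1 c == f2 c2]| * #|[set c in F2 | f2 c == f1 c1]| <=
    \sum_(c1 in F1) #|[set c2 in F2 | B c1 c2 || B c2 c1]|.
  apply: leq_trans (_ : \sum_(c in [set c in F1 | f1 c == f2 c2]) #|[set c2 in F2 | B c c2 || B c2 c]| <= _).
    apply: sum_in_geq_const => c; rewrite inE => /andP [cF /eqP ec].
    apply: subset_leq_card; apply/subsetP => c'; rewrite !inE => /andP [cF' /eqP ec'].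
    rewrite cF' /=; apply: contraNT ne; rewrite negb_or => /andP [b1 b2].
    by rewrite -ec -ec' (eqf c c').
  rewrite big_mkcond [leqRHS]big_mkcond /=; apply: leq_sum => c _.
  by rewrite inE; case: (c \in F1) => //=; case: ifP.
move: (leq_trans all (leq_trans cl12 Q1)) H1 H2 G1 G2 F1t F2t.
set a := #|[set c in F1 | f1 c == _]|; set b := #|[set c in F2 | f2 c == _]|.
set x := #|F1|; set y := #|F2|; clear; move=> ab H1 H2 G1 G2 xt yt.
have a3 : 3 * x <= 4 * a by lia.
have b3 : 3 * t < b by lia.
by have := leq_mul a3 b3; rewrite mulnS; nia.
Qed.

(** * Triangles at almost every blob *)

Section Triangles.
Context (C V : finType) (E : C -> rel V).
Hypothesis Ecl : forall c, clique_graph (E c).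
Context (g : ends C V) (o : C).
Hypothesis st : state E g o.
Context (n : nat).
Hypothesis nE : #|C| = n.
Context (h : nat) (X0 : {set V}).

Local Notation W := (W g o).
Local Notation adj := (adj E g o).
Local Notation heavy := (heavy E g o h).
Local Notation light := (light E g o h X0).
Local Notation doubled := (doubled E g o h X0).
Local Notation uncov := (uncov E g o).

Context (ind : rel C) (B J : {set C}) (K Q0 : nat).
Hypothesis heavyK : forall c, #|heavy c| <= K.
Hypothesis heavy_at : forall w, #|[set l | w \in heavy l]| <= K.
Hypothesis indQ : forall c, #|[set c1 | ~~ ind c1 c]| <= Q0.
Hypothesis oJ : o \notin J.

(** The obstructions to switching first with [c1] through [w] and then with [c2], or in the other
    order. *)
Definition clash w c1 c2 := [|| c1 == c2, w \in heavy c2 | ~~ ind c2 c1].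

Hypothesis pair_labels : forall j b c1 c2 w1 w2, j \in J -> c1 \in B -> c2 \in B ->
  c1 != j -> c2 != j -> light c1 w1 -> light c2 w2 ->
  ~~ clash w1 c1 c2 -> ~~ clash w2 c2 c1 ->
  E c1 (g j b) w1 -> E c2 (g j (~~ b)) w2 -> w1 = w2.

Let Q := 1 + K + Q0.

Lemma clash_few w c : #|[set y | clash w c y]| <= Q.
Proof.
apply: leq_trans (_ : #|[set c] :|: [set l | w \in heavy l] :|: [set c1 | ~~ ind c1 c]| <= _).
  apply: subset_leq_card; apply/subsetP => y; rewrite inE => /or3P [/eqP <-|wh|ni].
  - by rewrite !in_setU in_set1 eqxx.
  - by apply/setUP; left; apply/setUP; right; rewrite inE.
  - by apply/setUP; right; rewrite inE.
apply: leq_trans (cardsU_leq _ _) _; apply: leq_add => //.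
by apply: leq_trans (cardsU_leq _ _) _; rewrite cards1 leq_add2l.
Qed.

(** [common_label] uses a single relation for both orders of a pair, so the clash relations of the
    two labellings are united. *)
Lemma clash2_few (f1 f2 : C -> V) c : #|[set y | clash (f1 c) c y || clash (f2 c) c y]| <= 2 * Q.
Proof.
apply: leq_trans (_ : #|[set y | clash (f1 c) c y] :|: [set y | clash (f2 c) c y]| <= _).
  by apply: subset_leq_card; apply/subsetP => y; rewrite inE => /orP [] H; apply/setUP; [left|right]; rewrite inE.
by apply: leq_trans (cardsU_leq _ _) _; rewrite mul2n -addnn leq_add ?clash_few.
Qed.

(** For a doubled blob the two ends have different vertices, whereas [common_label] would make both
    labellings take the same value on almost all colours. The [+ 1] is the colour [j] itself. *)
Lemma doubled_few j : j \in J -> #|[set c in B | doubled c j]| <= 16 * Q + 1.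
Proof.
move=> jJ; pose F := [set c in B | doubled c j] :\ j.
have FE : #|[set c in B | doubled c j]| <= #|F| + 1.
  by rewrite (cardsD1 j [set c in B | doubled c j]) addnC leq_add2l; case: (_ \in _).
apply: leq_trans FE _; rewrite leq_add2r leqNgt; apply/negP => Fbig.
have [|f Hf] := @ex_fin_choice C (V * V)%type (g j true, g j true) (fun c => c \in F)
  (fun c q => [/\ q.1 != q.2, light c q.1, light c q.2, E c (g j true) q.1 & E c (g j false) q.2]).
  move=> c; rewrite !inE => /and3P [_ _ /andP [_ /existsP [w /existsP [w' /and5P [? ? ? ? ?]]]]].
  by exists (w, w').
have [||||||w [H1 H2]] := @common_label C V F F (fun c => (f c).1) (fun c => (f c).2)
  (fun c y => clash (f c).1 c y || clash (f c).2 c y) (2 * Q) (4 * Q).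
- exact: (clash2_few (fun c => (f c).1) (fun c => (f c).2)).
- move=> c1 c2 c1F c2F; rewrite negb_or => /andP [n1 _]; rewrite negb_or => /andP [_ n2].
  have [_ l1 _ e1 _] := Hf _ c1F; have [_ _ l2 _ e2] := Hf _ c2F.
  move: c1F c2F; rewrite !inE => /and3P [c1j c1B _] /and3P [c2j c2B _].
  exact: (pair_labels (b := true) jJ c1B c2B c1j c2j l1 l2 n1 n2 e1 e2).
- by clear; lia.
- by clear; lia.
- by move: Fbig; clear; lia.
- by move: Fbig; clear; lia.
have sub : F \subset [set c in F | (f c).1 != w] :|: [set c in F | (f c).2 != w].
  apply/subsetP => c cF; have [ne _ _ _ _] := Hf _ cF; rewrite !in_setU ![_ \in [set x in F | _]]inE cF /=.
  by rewrite -negb_and; apply: contra ne => /andP [/eqP -> /eqP ->].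
have := leq_trans (subset_leq_card sub) (cardsU_leq _ _).
by move: H1 H2 Fbig; clear; lia.
Qed.

Hypothesis free_labels : forall j b l b' c c1 c2 w1 w2, j \in J -> l \in J -> j != l ->
  c \in B -> c1 \in B -> c2 \in B -> c1 != c -> c2 != c ->
  c1 != j -> c2 != j -> c != j -> c1 != l -> c2 != l -> c != l ->
  ind c1 c -> ind c2 c -> w1 \notin heavy c -> w2 \notin heavy c ->
  light c1 w1 -> light c2 w2 -> ~~ clash w1 c1 c2 -> ~~ clash w2 c2 c1 ->
  E c1 (g j b) w1 -> E c2 (g l b') w2 -> E c (g j (~~ b)) (g l (~~ b')) -> w1 = w2.

Context (S : C -> {set V}) (phi : C -> V -> C * bool) (s t t0 : nat).
Hypothesis S_card : forall c, c \in B -> n + #|uncov c| <= #|S c| + s.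
Hypothesis S_light : forall c w, c \in B -> w \in S c -> light c w.
Hypothesis phi_inj : forall c, c \in B -> {in S c &, injective (phi c)}.
Hypothesis phi_end : forall c w, c \in B -> w \in S c ->
  (phi c w).1 != o /\ E c (g (phi c w).1 (phi c w).2) w.
Hypothesis B_large : #|~: B| <= s.
Hypothesis J_large : #|~: J| <= s.
Hypothesis s0 : 0 < s.
Hypothesis X0_small : 2 * (K + #|X0|) <= s.
Hypothesis s_sq : n * (16 * Q + 1) <= s * s.
Hypothesis t0_gt0 : 0 < t0.
Hypothesis t0_large : n * K <= t0 * s.
Hypothesis t_large : 8 * Q * n <= t * s.
Hypothesis s_large : 100 * (t + t0 + Q0 + 3) <= s.
Hypothesis n_large : 1000 * 1000 * s <= n.

Definition exits c p := [exists w in S c, phi c w == p].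
Definition exit_label c p := odflt (g o true) [pick w in S c | phi c w == p].
Definition exits_blob c j := exits c (j, true) || exits c (j, false).
Definition tri c j := [exists w, [&& light c w, E c (g j true) w & E c (g j false) w]].

Lemma exit_labelP c p : exits c p -> exit_label c p \in S c /\ phi c (exit_label c p) = p.
Proof.
rewrite /exit_label; case: pickP => [w /andP [wS /eqP e]|H] //.
by case/exists_inP => w wS /eqP e; have := H w; rewrite /= wS e eqxx.
Qed.

Lemma exit_edge c j b : c \in B -> exits c (j, b) ->
  light c (exit_label c (j, b)) /\ E c (g j b) (exit_label c (j, b)).
Proof.
move=> cB /exit_labelP [wS e]; split; first exact: S_light.
by have [_] := phi_end cB wS; rewrite e.
Qed.

Lemma exit_count c : c \in B ->
  n + #|uncov c| <= s + #|[set j in J | exits_blob c j]| + #|outn doubled c :&: J| + 2 * s.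
Proof.
move=> cB; have HS w : w \in S c -> light c w /\ ((phi c w).1 != o /\ E c (g (phi c w).1 (phi c w).2) w).
  by move=> wS; split; [apply: S_light | apply: phi_end].
have := exits_leq (phi_inj cB) HS.
have split_J (X : {set C}) : #|X| <= #|X :&: J| + s.
  rewrite -(cardsID J X) leq_add2l; apply: leq_trans J_large.
  by apply: subset_leq_card; rewrite setDE subsetIr.
have := split_J (outn doubled c); rewrite {1}/outn.
have := split_J (outn (leads E g o h) c :&: [set (phi c w).1 | w in S c]).
have sub : (outn (leads E g o h) c :&: [set (phi c w).1 | w in S c]) :&: J \subset
    [set j in J | exits_blob c j].
  apply/subsetP => j; rewrite !in_setI => /andP [/andP [_ /imsetP [w wS e]] jJ].
  rewrite inE jJ /= /exits_blob e; case ew: (phi c w) => [j' b'] /=.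
  by case: b' ew => ew; apply/orP; [left | right]; apply/exists_inP; exists w; rewrite ?ew.
by have := subset_leq_card sub; have := S_card cB; clear; lia.
Qed.

Definition B1 := [set c in B | #|outn doubled c :&: J| <= s].

Lemma B1B c : c \in B1 -> c \in B. Proof. by rewrite inE => /andP []. Qed.

Lemma B1_large : #|~: B1| <= 2 * s.
Proof.
have sum : arcs doubled B J <= n * (16 * Q + 1).
  rewrite arcs_swap; apply: leq_trans (_ : #|J| * (16 * Q + 1) <= _).
    by apply: sum_in_leq_const => j /doubled_few.
  by rewrite leq_mul2r card_leq_n ?orbT.
have H : #|B :\: B1| * s <= s * s.
  apply: leq_trans (leq_trans (_ : _ <= arcs doubled (B :\: B1) J) _) s_sq.
    apply: sum_in_geq_const => c; rewrite in_setD inE => /andP [H cB].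
    by rewrite cB /= -ltnNge in H; apply: ltnW.
  by apply: leq_trans sum; apply: arcsSl; apply: subsetDl.
have {}H : #|B :\: B1| <= s by rewrite -(@leq_pmul2r s).
have sub : ~: B1 \subset ~: B :|: (B :\: B1).
  by apply/subsetP => c; rewrite in_setU in_setD !in_setC => ->; case: (_ \in B).
have := leq_trans (subset_leq_card sub) (cardsU_leq _ _).
by move: H B_large; clear; lia.
Qed.

Definition fine c j := [&& j \in J, exits_blob c j, ~~ doubled c j, (j, true) \notin uncov c,
  (j, false) \notin uncov c & ~~ [exists w in heavy c :|: X0, adj c j w]].

Lemma fine_count c : c \in B1 -> #|[set j | ~~ fine c j]| <= 11 * s.
Proof.
move=> cB1; have cB := B1B cB1; have := cB1; rewrite inE cB /= => pc.
pose X1 := [set j in J | ~~ exits_blob c j]; pose X2 := [set p.1 | p in uncov c].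
pose X3 := [set j | [exists w in heavy c :|: X0, adj c j w]].
have X3s : #|X3| <= s.
  apply: leq_trans X0_small; apply: leq_trans (_ : #|heavy c :|: X0| * 2 <= _).
    by apply: card_exists_leq => w _; apply: card_adj_blob.
  by have := cardsU_leq (heavy c) X0; have := heavyK c; clear; lia.
have sub : [set j | ~~ fine c j] \subset ~: J :|: X1 :|: (outn doubled c :&: J) :|: X2 :|: X3.
  apply/subsetP => j; rewrite inE; apply: contraR.
  rewrite !in_setU => /norP [/norP [/norP [/norP [jJ j1] j2] j3] j4].
  rewrite in_setC negbK in jJ; rewrite inE jJ negbK in j1; apply/and5P; split=> //.
  - by apply: contra j2 => dj; rewrite in_setI inE dj jJ.
  - by apply: contra j3 => u; apply/imsetP; exists (j, true).
  - apply/andP; split; first by apply: contra j3 => u; apply/imsetP; exists (j, false).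
    by apply: contra j4 => H; rewrite inE.
have X2u : #|X2| <= #|uncov c| by apply: leq_imset_card.
have X1J : #|X1| + #|[set j in J | exits_blob c j]| <= n.
  apply: leq_trans (card_leq_n nE J); rewrite -(cardsID [set j | exits_blob c j] J) addnC; apply: leq_add.
    by apply: subset_leq_card; apply/subsetP => j; rewrite !inE.
  by apply: subset_leq_card; apply/subsetP => j; rewrite !inE => /andP [-> ->].
have := exit_count cB.
have := leq_trans (subset_leq_card sub) (cardsU_leq _ _).
have := cardsU_leq (~: J :|: X1 :|: (outn doubled c :&: J)) X2.
have := cardsU_leq (~: J :|: X1) (outn doubled c :&: J).
have := cardsU_leq (~: J) X1.
by move: X3s X2u X1J pc J_large; clear; lia.
Qed.

(** The end opposite to the exit is covered. A neighbour in [W] would give a triangle, a doubled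
    blob or an excluded vertex, so its neighbour is an end of another blob [l]. An exit of [c] at
    that same end of [l] would by transitivity give a neighbour in [W] after all, so [c] leaves [l]
    by the other end. *)
Lemma fine_partner c j : c \in B1 -> fine c j -> ~~ tri c j -> exists b l b',
  [/\ exits c (j, b), l != o, l != j, E c (g j (~~ b)) (g l b') &
      fine c l -> exits c (l, ~~ b')].
Proof.
move=> /B1B cB /and5P [jJ exj ndj cov1 /andP [cov2 /exists_inPn clean]] ntri.
have jo : j != o by apply: contraNneq oJ => <-.
have [b exb] : exists b, exits c (j, b) by case/orP: exj; [exists true | exists false].
have [lw Ew] := exit_edge cB exb; set w := exit_label c (j, b) in lw Ew.
have [wW _ _] := and3P lw.
have vW : g j (~~ b) \notin W by rewrite inE; apply/not_freeP; exists j, (~~ b).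
have noW w' : w' \in W -> E c (g j (~~ b)) w' = false.
  move=> w'W; apply/negP => Ew'.
  have : w' \notin heavy c :|: X0.
    apply: contraL (w'W) => /clean /negP; case; apply/adjP; split=> //; by exists (~~ b).
  rewrite in_setU negb_or => /andP [w'h w'X0].
  have lw' : light c w' by rewrite /light w'W w'X0 w'h.
  case: (eqVneq w w') => [e|ww'].
    case/negP: ntri; apply/existsP; exists w; rewrite lw /=; move: Ew Ew'; rewrite -e.
    by case: (b) => /= -> ->.
  case/negP: ndj; rewrite /doubled jo /=; case: (b) Ew Ew' => /= Ew Ew'.
    by apply/existsP; exists w; apply/existsP; exists w'; rewrite ww' lw lw' Ew Ew'.
  by apply/existsP; exists w'; apply/existsP; exists w; rewrite eq_sym ww' lw lw' Ew Ew'.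
have [u Eu] : exists u, E c u (g j (~~ b)).
  have : (j, ~~ b) \notin uncov c by case: (b).
  by rewrite inE jo /= negbK inE => /existsP.
rewrite (E_sym Ecl) in Eu.
have : u \notin W by apply: contraL Eu => /noW ->.
rewrite inE => /not_freeP [l [b' [lo e]]]; rewrite -e in Eu.
exists b, l, b'; split=> //.
- apply: contraTneq Eu => lj; rewrite lj; apply/negP => Eu.
  have bb : b' = b.
    by move: (E_neq Ecl Eu); case: (b) (b') => [] [] //; rewrite eqxx.
  rewrite bb in Eu; have := noW w wW; rewrite (E_trans Ecl Eu Ew) //.
  by apply: contraNneq vW => ->.
- case/and3P => _ exl _; suff nex : ~~ exits c (l, b').
    by move: exl nex; rewrite /exits_blob; case: (b') => /= /orP [] // ->.
  apply/negP => exl'; have [lw' Ew'] := exit_edge cB exl'; have [w'W _ _] := and3P lw'.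
  have := noW _ w'W; rewrite (E_trans Ecl Eu Ew') //.
  by apply: contraNneq vW => ->.
Qed.

Definition family p := [set c in B1 | exits c p].
Definition visitors j := [set c in B1 | exits_blob c j].
Definition rare p := #|family p| < s.
Definition poor j := 10 * #|visitors j| < 9 * n.
(** The ends where the argument of [no_partner] may break down: few colours exit there, or many do
    so through vertices heavy for [c], or the blob itself is exceptional. *)
Definition bad c := [set p : C * bool | [|| exits c p && rare p,
  t0 <= #|[set c' in family p | exit_label c' p \in heavy c]|,
  poor p.1, p.1 == c | ~~ fine c p.1]].

Definition users j w := [set c in B1 | (w \in S c) && ((phi c w).1 == j)].

(** The colours leaving by the other end are either fewer than [s], or [common_label] forces them to
    use the same vertex [w]. *)
Lemma users_large j b w : j \in J -> s <= #|family (j, b)| ->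
  50 * #|[set c in family (j, b) | exit_label c (j, b) != w]| <= s ->
  #|visitors j| <= #|users j w| + 2 * s.
Proof.
move=> jJ big few.
have use b' c : c \in family (j, b') -> exit_label c (j, b') = w -> c \in users j w.
  rewrite inE => /andP [cB1 /exit_labelP [wS e]] <-; by rewrite inE cB1 wS e /=.
have sub : visitors j \subset users j w :|:
    ([set c in family (j, b) | exit_label c (j, b) != w] :|:
     [set c in family (j, ~~ b) | exit_label c (j, ~~ b) != w]).
  apply/subsetP => c; rewrite inE => /andP [cB1 ex].
  have [b' exb'] : exists b', exits c (j, b') by case/orP: ex; [exists true | exists false].
  have cF : c \in family (j, b') by rewrite inE cB1.
  case: (eqVneq (exit_label c (j, b')) w) => [e|ne]; first by rewrite in_setU (use _ _ cF e).
  apply/setUP; right; apply/setUP.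
  case: (eqVneq b' b) => [e|neb]; [left|right]; first by rewrite inE -e cF.
  have -> : ~~ b = b' by case: (b) b' neb {exb' cF ne} => [] [].
  by rewrite inE cF.
apply: leq_trans (subset_leq_card sub) _; apply: leq_trans (cardsU_leq _ _) _.
rewrite leq_add2l; apply: leq_trans (cardsU_leq _ _) _.
set a := #|_| in few *; set a' := #|_|.
suff : a' <= s by move: few; clear; lia.
case: (ltnP #|family (j, ~~ b)| s) => [small|big'].
  apply: leq_trans (ltnW small); apply: subset_leq_card; apply/subsetP => c.
  by rewrite inE => /andP [].
pose F1 := family (j, b) :\ j; pose F2 := family (j, ~~ b) :\ j.
have F1E : #|family (j, b)| <= #|F1| + 1.
  by rewrite (cardsD1 j) addnC leq_add2l; case: (_ \in _).
have F2E : #|family (j, ~~ b)| <= #|F2| + 1.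
  by rewrite (cardsD1 j) addnC leq_add2l; case: (_ \in _).
have tF (F : {set C}) : s <= #|F| + 1 -> 2 * Q * (#|F1| + #|F2|) <= t * #|F|.
  move=> Fs; have sF : s <= 2 * #|F| by move: s_large Fs; clear; lia.
  rewrite -(@leq_pmul2l 2) //; apply: leq_trans (leq_trans _ t_large) _.
    by have := leq_mul (leqnn (4 * Q)) (leq_add (card_leq_n nE F1) (card_leq_n nE F2)); clear; lia.
  by rewrite mulnCA leq_mul2l sF orbT.
have [||||||w2 [H1 H2]] := @common_label C V F1 F2 (fun c => exit_label c (j, b))
  (fun c => exit_label c (j, ~~ b))
  (fun c y => clash (exit_label c (j, b)) c y || clash (exit_label c (j, ~~ b)) c y) (2 * Q) t.
- exact: (clash2_few (fun c => exit_label c (j, b)) (fun c => exit_label c (j, ~~ b))).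
- move=> c1 c2; rewrite !in_setD1 ![_ \in family _]inE.
  move=> /andP [c1j /andP [/B1B c1B ex1]] /andP [c2j /andP [/B1B c2B ex2]].
  rewrite negb_or => /andP [n1 _]; rewrite negb_or => /andP [_ n2].
  have [l1 e1] := exit_edge c1B ex1; have [l2 e2] := exit_edge c2B ex2.
  exact: (pair_labels jJ c1B c2B c1j c2j l1 l2 n1 n2 e1 e2).
- by apply: tF; move: big F1E; clear; lia.
- by apply: tF; move: big' F2E; clear; lia.
- by move: big F1E s_large; clear; lia.
- by move: big' F2E s_large; clear; lia.
have ww2 : w = w2.
  have [c cF1 cN] : exists2 c, c \in F1 &
      c \notin [set c in family (j, b) | exit_label c (j, b) != w] :|: [set c in F1 | exit_label c (j, b) != w2].
    apply: subset_card_ltn_ex; apply: leq_ltn_trans (cardsU_leq _ _) _.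
    by rewrite -/a; move: few H1 F1E big s_large; clear; lia.
  have cF : c \in family (j, b) by move: cF1; rewrite in_setD1 => /andP [].
  move: cN; rewrite in_setU => /norP [].
  by rewrite inE cF negbK => /eqP <-; rewrite inE cF1 negbK => /eqP <-.
apply: leq_trans (_ : #|[set c in F2 | exit_label c (j, ~~ b) != w2] :|: [set j]| <= _).
  apply: subset_leq_card; apply/subsetP => c; rewrite inE => /andP [cF ne].
  rewrite in_setU in_set1 inE in_setD1 cF -ww2 ne /= andbT.
  by case: (c == j).
apply: leq_trans (cardsU_leq _ _) _; rewrite cards1.
by move: H2 s_large; clear; lia.
Qed.

Definition trimmed c j l p := [set c' in family p |
  [&& c' != j, c' != l, c' != c, exit_label c' p \notin heavy c & ind c' c]].

Lemma trimmed_compl c j l p :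
  #|[set c' in family p | exit_label c' p \in heavy c]| < t0 ->
  #|family p :\: trimmed c j l p| <= t0 + Q0 + 3.
Proof.
move=> Ht; set X1 := [set c' in family p | _] in Ht; pose X2 := [set c1 | ~~ ind c1 c].
apply: leq_trans (_ : #|X1 :|: X2 :|: [set j; l; c]| <= _).
  apply: subset_leq_card; apply/subsetP => c'; rewrite in_setD => /andP [nt cF].
  apply: contraR nt; rewrite !in_setU.
  move=> /norP [/norP [n1 n2] n3]; rewrite inE cF /=; rewrite !inE in n3.
  move: n3 => /norP [/norP [-> ->] ->] /=.
  rewrite inE cF /= in n1; rewrite n1 /=; by rewrite inE negbK in n2.
apply: leq_trans (cardsU_leq _ _) _; have := cardsU_leq X1 X2; have := indQ c.
have := cardsU_leq [set j; l] [set c]; rewrite cards1 cards2 -/X2.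
by move: Ht; case: (j != l); clear; lia.
Qed.

Lemma badN c p : exits c p -> p \notin bad c ->
  [/\ s <= #|family p|, #|[set c' in family p | exit_label c' p \in heavy c]| < t0,
      9 * n <= 10 * #|visitors p.1|, p.1 != c & fine c p.1].
Proof.
move=> ex; rewrite inE ex => /norP [H1 /norP [H2 /norP [H3 /norP [H4 H5]]]]; split=> //.
- by rewrite leqNgt.
- by rewrite ltnNge.
- by rewrite leqNgt.
- by rewrite negbK in H5.
Qed.

(** By [free_labels], the colours leaving [j] and those leaving [l] almost all share one vertex [w],
    and [users_large] extends this to nearly all visitors of the two blobs. *)
Lemma no_partner c j (b : bool) l (b' : bool) : c \in B1 -> j \in J -> l \in J -> j != l ->
  exits c (j, b) -> exits c (l, b') -> E c (g j (~~ b)) (g l (~~ b')) ->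
  (j, b) \notin bad c -> (l, b') \notin bad c -> False.
Proof.
move=> cB1 jJ lJ jl exj exl Ejl /(badN exj) [/= bigj fewj vj jc _] /(badN exl) [/= bigl fewl vl lc _].
have cB := B1B cB1.
pose F1 := trimmed c j l (j, b); pose F2 := trimmed c j l (l, b').
have D1 : #|family (j, b) :\: F1| <= t0 + Q0 + 3 by apply: trimmed_compl.
have D2 : #|family (l, b') :\: F2| <= t0 + Q0 + 3 by apply: trimmed_compl.
have F1E : #|family (j, b)| <= #|F1| + (t0 + Q0 + 3).
  by rewrite -(cardsID F1 (family _)); apply: leq_add D1; apply: subset_leq_card; apply: subsetIr.
have F2E : #|family (l, b')| <= #|F2| + (t0 + Q0 + 3).
  by rewrite -(cardsID F2 (family _)); apply: leq_add D2; apply: subset_leq_card; apply: subsetIr.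
have tF (F : {set C}) : s <= #|F| + (t0 + Q0 + 3) -> 2 * Q * (#|F1| + #|F2|) <= t * #|F|.
  move=> Fs; have sF : s <= 2 * #|F| by move: s_large Fs; clear; lia.
  rewrite -(@leq_pmul2l 2) //; apply: leq_trans (leq_trans _ t_large) _.
    by have := leq_mul (leqnn (4 * Q)) (leq_add (card_leq_n nE F1) (card_leq_n nE F2)); clear; lia.
  by rewrite mulnCA leq_mul2l sF orbT.
have [||||||w [H1 H2]] := @common_label C V F1 F2 (fun c' => exit_label c' (j, b))
  (fun c' => exit_label c' (l, b'))
  (fun c' y => clash (exit_label c' (j, b)) c' y || clash (exit_label c' (l, b')) c' y) (2 * Q) t.
- exact: (clash2_few (fun c => exit_label c (j, b)) (fun c => exit_label c (l, b'))).
- move=> c1 c2; rewrite inE => /andP [c1F /and5P [c1j c1l c1c h1 i1]].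
  rewrite inE => /andP [c2F /and5P [c2j c2l c2c h2 i2]].
  rewrite negb_or => /andP [n1 _]; rewrite negb_or => /andP [_ n2].
  move: c1F; rewrite inE => /andP [/B1B c1B ex1]; move: c2F; rewrite inE => /andP [/B1B c2B ex2].
  have [l1 e1] := exit_edge c1B ex1; have [l2 e2] := exit_edge c2B ex2.
  rewrite eq_sym in jc; rewrite eq_sym in lc.
  exact: (free_labels jJ lJ jl cB c1B c2B c1c c2c c1j c2j jc c1l c2l lc i1 i2 h1 h2 l1 l2 n1 n2 e1 e2 Ejl).
- by apply: tF; apply: leq_trans bigj F1E.
- by apply: tF; apply: leq_trans bigl F2E.
- by move: bigj F1E s_large; clear; lia.
- by move: bigl F2E s_large; clear; lia.
have few (F F' : {set C}) (f : C -> V) : #|F :\: F'| <= t0 + Q0 + 3 ->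
    #|[set c' in F' | f c' != w]| <= t -> 50 * #|[set c' in F | f c' != w]| <= s.
  move=> DF HF; have sub : [set c' in F | f c' != w] \subset (F :\: F') :|: [set c' in F' | f c' != w].
    apply/subsetP => x; rewrite inE => /andP [xF ne]; rewrite in_setU in_setD xF andbT inE ne andbT.
    by case: (x \in F').
  have := leq_trans (subset_leq_card sub) (cardsU_leq _ _).
  by move: DF HF s_large; clear; lia.
have U1 := users_large jJ bigj (few _ _ _ D1 H1).
have U2 := users_large lJ bigl (few _ _ _ D2 H2).
(* A colour exits through [w] to one blob only, yet both sets contain nearly 9n/10 colours. *)
have : #|users j w| + #|users l w| <= n.
  rewrite -cardsUI (_ : _ :&: _ = set0) ?cards0 ?addn0 ?card_leq_n //.
  apply/setP => c'; rewrite !inE; apply/negP => /andP [/and3P [_ _ /eqP e1] /and3P [_ _ /eqP e2]].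
  by move: jl; rewrite -e1 -e2 eqxx.
by move: U1 U2 vj vl n_large s0; clear; lia.
Qed.

Lemma bad_unfine c j b : ~~ fine c j -> (j, b) \in bad c.
Proof. by move=> H; rewrite inE; apply/or4P; apply: Or44; apply/orP; right. Qed.

Lemma tri_bad c j : c \in B1 -> ~~ tri c j ->
  j \in [set p.1 | p in bad c] :|: [set j | [exists p in bad c, adj c j (g p.1 (~~ p.2))]].
Proof.
move=> cB1 ntri; rewrite in_setU; case: (boolP (fine c j)) => fj; last first.
  by apply/orP; left; apply/imsetP; exists (j, true) => //; apply: bad_unfine.
have [b [l [b' [exj lo lj Ejl exl]]]] := fine_partner cB1 fj ntri.
case: (boolP ((j, b) \in bad c)) => bj; first by apply/orP; left; apply/imsetP; exists (j, b).
suff bl : (l, ~~ b') \in bad c.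
  apply/orP; right; rewrite inE; apply/exists_inP; exists (l, ~~ b') => //=; apply/adjP.
  have [jJ _] := andP fj; split; first by apply: contraNneq oJ => <-.
  by exists (~~ b); rewrite negbK.
case: (boolP (fine c l)) => fl; last exact: bad_unfine.
apply/negPn/negP => bl; have [jJ _] := andP fj; have [lJ _] := andP fl.
by apply: (no_partner cB1 jJ lJ _ exj (exl fl) _ bj bl); rewrite ?negbK // eq_sym.
Qed.

(** A blob without a triangle belongs to a bad end, or is joined by [c] to the end opposite to a bad
    one; the latter happens for at most two blobs per bad end. *)
Lemma tri_count c : c \in B1 -> #|[set j | ~~ tri c j]| <= 3 * #|bad c|.
Proof.
move=> cB1; apply: leq_trans (_ : #|[set p.1 | p in bad c] :|:
    [set j | [exists p in bad c, adj c j (g p.1 (~~ p.2))]]| <= _).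
  by apply: subset_leq_card; apply/subsetP => j; rewrite inE; apply: tri_bad.
apply: leq_trans (cardsU_leq _ _) _; rewrite mulSn; apply: leq_add; first exact: leq_imset_card.
by rewrite mulnC; apply: card_exists_leq => p _; apply: card_adj_blob.
Qed.

(** More than n/10 colours miss a poor blob, while a colour of [B1] misses at most 11s blobs and
    only 2s colours lie outside [B1]. *)
Lemma poor_count : #|[set j | poor j]| <= 130 * s.
Proof.
have miss : \sum_j #|[set c | ~~ ((c \in B1) && exits_blob c j)]| <= 13 * s * n.
  rewrite sum_card_rel (bigID (mem B1)) /= (_ : 13 * s * n = n * (11 * s) + 2 * s * n); last by clear; lia.
  apply: leq_add.
    apply: leq_trans (_ : #|B1| * (11 * s) <= _); last by rewrite leq_mul2r card_leq_n ?orbT.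
    apply: sum_in_leq_const => c cB1; apply: leq_trans (fine_count cB1).
    apply: subset_leq_card; apply/subsetP => j; rewrite inE [_ \in [set j | ~~ fine c j]]inE cB1.
    by apply: contra => /and5P [].
  apply: leq_trans (_ : #|~: B1| * n <= _); last by rewrite leq_mul2r B1_large orbT.
  rewrite (eq_bigl (fun c => c \in ~: B1)); last by move=> c; rewrite in_setC.
  by apply: sum_in_leq_const => c _; apply: card_leq_n.
have H : #|[set j | poor j]| * n <= 10 * (13 * s * n).
  apply: leq_trans (leq_mul (leqnn 10) miss).
  rewrite big_distrr /= [leqRHS](bigID (mem [set j | poor j])) /=; apply: leq_trans (leq_addr _ _).
  apply: sum_in_geq_const => j; rewrite inE /poor => Hj.
  have : #|visitors j| + #|[set c | ~~ ((c \in B1) && exits_blob c j)]| = n.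
    rewrite -nE -(cardsC (visitors j)); congr (_ + _).
    by apply: eq_card => c; rewrite !inE.
  by move: Hj; clear; lia.
rewrite -(@leq_pmul2r n); last by move: n_large s0; clear; lia.
by move: H; clear; lia.
Qed.

Lemma bad_count c : c \in B1 ->
  #|bad c| <= #|[set p | exits c p && rare p]| + 284 * s.
Proof.
move=> cB1; pose P1 := [set p | t0 <= #|[set c' in family p | exit_label c' p \in heavy c]|].
(* A colour uses different vertices at different ends, so at most [K] of its exit vertices are heavy
   for [c]; double counting bounds |P1| by nK/t0. *)
have P1s : #|P1| <= s.
  have H : #|P1| * t0 <= n * K.
    rewrite -nE; apply: markov_rel => c'; apply: leq_trans (heavyK c).
    apply: (card_inj_on (f := exit_label c')) => [p q|p]; rewrite !inE.
      move=> /andP [/andP [_ /exit_labelP [_ ep]] _] /andP [/andP [_ /exit_labelP [_ eq]] _] e.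
      by rewrite -ep -eq e.
    by case/andP.
  by rewrite -(@leq_pmul2r t0) //; apply: leq_trans H _; rewrite [s * _]mulnC.
have fst_card (X : {set C}) : #|[set p : C * bool | p.1 \in X]| <= 2 * #|X|.
  rewrite (_ : [set p | _] = setX X [set: bool]); first by rewrite cardsX cardsT card_bool mulnC.
  by apply/setP => -[x b]; rewrite !inE andbT.
pose P0 := [set p | exits c p && rare p]; pose P2 := [set p : C * bool | p.1 \in [set j | poor j]].
pose P3 := [set p : C * bool | p.1 \in [set c]].
pose P4 := [set p : C * bool | p.1 \in [set j | ~~ fine c j]].
have sub : bad c \subset P0 :|: P1 :|: P2 :|: P3 :|: P4.
  apply/subsetP => p; rewrite inE => /or4P [H|H|H|/orP [H|H]].
  - by do 4!(apply/setUP; left); rewrite inE.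
  - by do 3!(apply/setUP; left); apply/setUP; right; rewrite inE.
  - by do 2!(apply/setUP; left); apply/setUP; right; rewrite inE inE.
  - by apply/setUP; left; apply/setUP; right; rewrite inE inE.
  - by apply/setUP; right; rewrite inE inE.
have U4 := cardsU_leq (P0 :|: P1 :|: P2 :|: P3) P4; have U3 := cardsU_leq (P0 :|: P1 :|: P2) P3.
have U2 := cardsU_leq (P0 :|: P1) P2; have U1 := cardsU_leq P0 P1.
have P2s : #|P2| <= 2 * (130 * s).
  by apply: leq_trans (fst_card _) _; rewrite leq_mul2l poor_count.
have P3s : #|P3| <= 2 by apply: leq_trans (fst_card _) _; rewrite cards1.
have P4s : #|P4| <= 2 * (11 * s).
  by apply: leq_trans (fst_card _) _; rewrite leq_mul2l fine_count.
apply: leq_trans (subset_leq_card sub) _; rewrite -/P0.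
by move: U4 U3 U2 U1 P1s P2s P3s P4s s_large; clear; lia.
Qed.

(** Rare ends are controlled only on average over the colours: each of the 2n ends is rare for fewer
    than [s] of them. The total is 860 = 3·2 + 3·284 + 2. *)
Lemma tri_sum : \sum_j #|[set c | ~~ ((c \in B1) && tri c j)]| <= 860 * s * n.
Proof.
have rare_sum : \sum_c #|[set p | [&& c \in B1, exits c p & rare p]]| <= n * 2 * s.
  rewrite sum_card_rel; apply: leq_trans (_ : #|{: C * bool}| * s <= _); last first.
    by rewrite card_prod card_bool nE.
  apply: sum_leq_const => p; case: (ltnP #|family p| s) => [H|H].
    apply: leq_trans (ltnW H); apply: subset_leq_card; apply/subsetP => c; rewrite !inE.
    by case/and3P => -> ->.
  rewrite (_ : [set c | _] = set0) ?cards0 //; apply/setP => c; rewrite in_set0 inE /rare ltnNge H.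
  by rewrite !andbF.
have HB c : c \in B1 -> #|[set j | ~~ tri c j]| <=
    3 * #|[set p | [&& c \in B1, exits c p & rare p]]| + 852 * s.
  move=> cB1; apply: leq_trans (tri_count cB1) _.
  have -> : [set p | [&& c \in B1, exits c p & rare p]] = [set p | exits c p && rare p].
    by apply/setP => p; rewrite inE cB1 [RHS]inE.
  by have := bad_count cB1; clear; lia.
rewrite sum_card_rel (bigID (mem B1)) /=.
have -> : 860 * s * n = (3 * (n * 2 * s) + n * (852 * s)) + 2 * s * n by clear; lia.
apply: leq_add.
  apply: leq_trans (_ : \sum_(c in B1) (3 * #|[set p | [&& c \in B1, exits c p & rare p]]| + 852 * s) <= _).
    apply: leq_sum => c cB1; apply: leq_trans (HB c cB1); apply: subset_leq_card.
    by apply/subsetP => j; rewrite inE [_ \in [set j | ~~ tri c j]]inE cB1.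
  rewrite big_split /=; apply: leq_add; last first.
    by rewrite sum_nat_const leq_mul2r card_leq_n ?orbT.
  rewrite -big_distrr leq_mul2l /=; apply: leq_trans rare_sum.
  by rewrite [leqRHS](bigID (mem B1)) /= leq_addr.
apply: leq_trans (_ : #|~: B1| * n <= _); last by rewrite leq_mul2r B1_large orbT.
rewrite (eq_bigl (fun c => c \in ~: B1)); last by move=> c; rewrite in_setC.
by apply: sum_in_leq_const => c _; apply: card_leq_n.
Qed.

Lemma regular_exists : exists (R : {set C}) (ctr : C -> V),
  [/\ 50 * #|~: R| <= n, o \notin R & forall j, j \in R ->
    ctr j \in W /\ 4 * #|[set c | E c (g j true) (ctr j) && E c (g j false) (ctr j)]| > 3 * n].
Proof.
pose miss j := #|[set c | ~~ ((c \in B1) && tri c j)]|.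
(* Then |N| is at most 20·860·s. Together with the [s] blobs outside [J] and the factor 50 of the
   conclusion this stays below 1000·1000·s, whence that constant. *)
pose N := [set j | n <= 20 * miss j].
have Ns : #|N| <= 20 * 860 * s.
  rewrite -(@leq_pmul2r n); last by move: n_large s0; clear; lia.
  have -> : 20 * 860 * s * n = 20 * (860 * s * n) by clear; lia.
  apply: leq_trans (leq_mul (leqnn 20) tri_sum).
  rewrite big_distrr /= [leqRHS](bigID (mem N)) /=; apply: leq_trans (leq_addr _ _).
  by apply: sum_in_geq_const => j; rewrite inE.
have Hctr j : j \in J :\: N -> exists w, w \in W /\
    4 * #|[set c | E c (g j true) w && E c (g j false) w]| > 3 * n.
  rewrite in_setD => /andP [jN jJ]; rewrite inE -ltnNge in jN.
  pose F := [set c in B1 | tri c j] :\ j.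
  have Fbig : n <= #|F| + miss j + 1.
    rewrite -nE -(cardsC [set c in B1 | tri c j]) (cardsD1 j [set c in B1 | _]) -/F.
    have -> : #|~: [set c in B1 | tri c j]| = miss j.
      by rewrite /miss; apply: eq_card => c; rewrite !inE.
    by case: (_ \in _); clear; lia.
  have Fn : 19 * n <= 20 * #|F| + 20 by move: jN Fbig; clear; lia.
  have [|f Hf] := @ex_fin_choice C V (g o true) (fun c => c \in F)
    (fun c w => [/\ light c w, E c (g j true) w & E c (g j false) w]).
    move=> c; rewrite in_setD1 inE => /and3P [_ _ /existsP [w /and3P [? ? ?]]].
    by exists w.
  have Qs : 8 * Q <= s.
    rewrite -(@leq_pmul2r n); last by move: n_large s0; clear; lia.
    apply: leq_trans t_large _; rewrite mulnC; apply: leq_mul => //.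
    by move: n_large s_large; clear; lia.
  have [||||||w [H _]] := @common_label C V F F f f (fun c y => clash (f c) c y) Q (2 * Q).
  - by move=> x; apply: clash_few.
  - move=> c1 c2 c1F c2F n1 n2; have [l1 e1 _] := Hf _ c1F; have [l2 _ e2] := Hf _ c2F.
    move: c1F c2F; rewrite !in_setD1 ![_ \in [set c in B1 | _]]inE.
    move=> /and3P [c1j /B1B c1B _] /and3P [c2j /B1B c2B _].
    exact: (pair_labels (b := true) jJ c1B c2B c1j c2j l1 l2 n1 n2 e1 e2).
  - by clear; lia.
  - by clear; lia.
  - by move: Fn n_large s0 Qs; clear; lia.
  - by move: Fn n_large s0 Qs; clear; lia.
  have sub : F \subset [set c in F | f c != w] :|: [set c in F | f c == w].
    apply/subsetP => c cF; rewrite in_setU; case: (eqVneq (f c) w) => e; last by rewrite inE cF e.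
    by apply/orP; right; rewrite inE cF e eqxx.
  have subE : [set c in F | f c == w] \subset [set c | E c (g j true) w && E c (g j false) w].
    by apply/subsetP => c; rewrite inE => /andP [cF /eqP <-]; have [_ e1 e2] := Hf _ cF; rewrite inE e1.
  have Fw := leq_trans (subset_leq_card sub) (cardsU_leq _ _).
  have Ew := subset_leq_card subE.
  exists w; split; last by move: H Fw Ew Fn Qs n_large s0; clear; lia.
  have [c cF cw] : exists2 c, c \in F & c \notin [set c in F | f c != w].
    by apply: subset_card_ltn_ex; move: H Fn Qs n_large s0; clear; lia.
  have [/and3P [fW _ _] _ _] := Hf _ cF.
  by move: cw; rewrite inE cF negbK => /eqP <-.
have [ctr Hc] := ex_fin_choice (g o true) Hctr.
exists (J :\: N), ctr; split=> //; last by rewrite in_setD (negbTE oJ) andbF.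
have sub : ~: (J :\: N) \subset ~: J :|: N.
  by apply/subsetP => j; rewrite in_setU !in_setC in_setD negb_and negbK orbC.
have := leq_trans (subset_leq_card sub) (cardsU_leq _ _).
by move: J_large Ns n_large; clear; lia.
Qed.
End Triangles.

Lemma few_atypical x n s d : 1000 * 1000 * 100 * x <= n -> n <= 2 * (1000 * 1000) * s ->
  4 * d <= s -> 2 * (x + d) <= s.
Proof. lia. Qed.

(** The arithmetic of the edge count, with [e] the arcs leaving the core, [x] its atypical colours
    and [q] the doublings per blob. The 60 is (10 + 4 + 1)·4, from atypical colours, leaving arcs,
    bounded terms, and [n <= 4 * a]. *)
Lemma complement_leq k n a b e x d q r : a + b = n -> n <= 4 * a -> 0 < n ->
  a * n <= a * (a + (x + d) + r) + 2 * e + n * q ->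
  k * e <= 2 * (n * n) -> k * x <= 10 * n -> k * (q + d + r) <= n -> k * b <= 60 * n.
Proof.
move=> ab n4 n0 H ke kx kq; rewrite -(@leq_pmul2r n) //.
apply: leq_trans (_ : 4 * (k * (a * b)) <= _).
  by have := leq_mul (leqnn (k * b)) n4; clear; lia.
have {}H : a * b <= a * (x + d + r) + 2 * e + n * q.
  by move: H; rewrite -{1}ab !mulnDr; clear; lia.
have an : a <= n by rewrite -ab leq_addr.
have H1 : k * (a * x) <= n * (10 * n) by rewrite mulnCA; apply: leq_mul.
have H2 : a * (k * (d + r)) + n * (k * q) <= n * n.
  apply: leq_trans (leq_add (leq_mul an (leqnn _)) (leqnn _)) _.
  rewrite -mulnDr leq_mul2l; apply/orP; right; apply: leq_trans kq.
  by rewrite -mulnDr leq_mul2l; apply/orP; right; clear; lia.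
have := leq_mul (leqnn k) H; move: H1 H2 ke; clear; lia.
Qed.

Lemma halves x y s : 2 * x <= s -> 2 * y <= s -> x + y <= s.
Proof. lia. Qed.

(** * Assembling the regular structure and choosing the parameters *)

Section Regular.
Context (C V : finType) (E : C -> rel V).
Hypothesis Ecl : forall c, clique_graph (E c).
Hypothesis nofull : forall g, ~ full E g.
Context (g : ends C V) (o : C).
Hypothesis st : state E g o.
Context (n : nat).
Hypothesis nE : #|C| = n.
Hypothesis Ecov : forall c, 3 * n <= #|covered (E c)| + 2.
Context (h K k T f d s Q q : nat).
Hypothesis h0 : 0 < h.
Hypothesis hK : 4 * n <= K * h.
Hypothesis k_large : 1000 * 1000 * 1000 <= k.
Hypothesis TE : T = 4 * k * k + 2.
Hypothesis h_small : 96 * k * (T + 2) * h <= n.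
Hypothesis dE : d = 2 * k + 2.
Hypothesis fE : f = d + 2 * K + 3 * (T + 2) + 10.
Hypothesis f_small : 4 * k * (f + 1 + 16 * k * f) < n.
Hypothesis QE : Q = 1 + K + 64 * k * K.
Hypothesis qE : q = 16 * Q + 1 + (d + 64 * k * d).
Hypothesis n_hub : 100 * (3 * (2 * k + 1) + K) + 2 * k * (6 * k + 4) <= n.
Hypothesis n_q : k * (q + 2 * d + (3 * (2 * k + 1) + K)) <= n.
Hypothesis s_lower : n <= 2 * (1000 * 1000) * s.
Hypothesis s_upper : 1000 * 1000 * s <= n.
Hypothesis s_labels :
  100 * (16 * (1000 * 1000) * Q + (2 * (1000 * 1000) * K + 1) + 64 * k * K + 3) <= s.
Hypothesis s_pairs : 2 * (1000 * 1000) * (16 * Q + 1) <= s.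
Hypothesis s_heavy : 2 * (K + d) <= s.
Hypothesis s_exits : 3 * (2 * k + 1) + K + d <= s.
Hypothesis s_q : 4 * q <= s.

Local Notation W := (W g o).
Local Notation near := (near E g o).
Local Notation adj := (adj E g o).
Local Notation heavy := (heavy E g o h).
Local Notation leads := (leads E g o h).
Local Notation via := (via E g o).
Local Notation light := (light E g o h).
Local Notation doubled := (doubled E g o h).

Let k0 : 0 < k. Proof. by move: k_large; clear; lia. Qed.

Lemma via_exceed (Z : {set V}) m : #|Z| <= m -> #|[set c | n < 32 * k * via c Z]| <= 64 * k * m.
Proof.
move=> Zm; set r := (n %/ (32 * k)).+1.
have n_lt : n < 32 * k * r by rewrite mulnC ltn_ceil; lia.
have sub : [set l | n < 32 * k * via l Z] \subset [set l | r <= via l Z].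
  by apply/subsetP => l; rewrite !inE /r ltn_divLR ?[_ * (32 * k)]mulnC //; lia.
apply: leq_trans (subset_leq_card sub) _; set x := #|_|.
have Hx : x * r <= n * (#|Z| * 2) by apply: via_large.
have n0 : 0 < n by move: f_small; clear; lia.
rewrite -(@leq_pmul2r n) //; apply: leq_trans (_ : 32 * k * (x * r) <= _).
  by have := leq_mul (leqnn x) (ltnW n_lt); clear; lia.
by have := leq_mul (leqnn (32 * k)) Hx; have := leq_mul (leqnn (64 * k * n)) Zm; clear; lia.
Qed.

Theorem regular_structure : exists (R : {set C}) (ctr : C -> V),
  [/\ 50 * #|~: R| <= n, o \notin R & forall j, j \in R ->
    ctr j \in W /\ 4 * #|[set c | E c (g j true) (ctr j) && E c (g j false) (ctr j)]| > 3 * n].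
Proof.
have kl : 1000 <= k by move: k_large; clear; lia.
have [A [Alegit Abig Aclosed Atyp Areach]] := hub_exists Ecl nofull st nE Ecov h0 hK kl n_hub.
pose typ := [set i in A | n <= 4 * #|outn leads i :&: A|].
have typ_small : 1000 * 1000 * 100 * #|A :\: typ| <= n.
  have := leq_mul k_large (leqnn #|A :\: typ|); rewrite -/typ in Atyp.
  by move: Atyp; clear; lia.
have n0 : 0 < n by move: f_small; clear; lia.
have [a aA aN] : exists2 a, a \in A & a \notin A :\: typ.
  by apply: subset_card_ltn_ex; move: typ_small Abig n0; clear; lia.
have {aN} : a \in typ by move: aN; rewrite in_setD aA andbT negbK.
rewrite inE aA /= => a_typ; have a_open : open_colour E g o n h A a.
  by apply: leq_trans a_typ _; rewrite leq_mul2r orbT.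
have [D0 [X0 [g0 [nr0 D0d X0d]]]] := Alegit a aA.
have {}D0d : #|D0| <= d by move: D0d dE; clear; lia.
have {}X0d : #|X0| <= d by move: X0d dE; clear; lia.
have oD0 : o \in D0 by case: nr0.
have fl : d + 2 * K + 3 * (T + 2) + 10 <= f by rewrite fE.
pose B := [set c | calm E g o n k A D0 X0 c].
pose J := [set j in A | usable E g o n h A D0 j].
pose ind : rel C := indep E g o n h k.
have heavyK c : #|heavy c| <= K by apply: (heavy_leq Ecl g o nE h0 hK).
have heavy_at w : #|[set l | w \in heavy l]| <= K by apply: (heavy_at_leq Ecl st nE h0 hK).
have indQ c : #|[set c1 | ~~ ind c1 c]| <= 64 * k * K.
  apply: leq_trans (via_exceed (heavyK c)); apply: subset_leq_card; apply/subsetP => x.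
  by rewrite inE [_ \in [set c | n < _]]inE -ltnNge.
have oJ : o \notin J by rewrite inE /usable oD0 andbF.
have lightW c c' w : light X0 c w -> w \notin heavy c' -> light X0 c' w.
  by case/and3P => wW wX _ wh; apply/and3P.
have pair_labels j b c1 c2 w1 w2 : j \in J -> c1 \in B -> c2 \in B ->
    c1 != j -> c2 != j -> light X0 c1 w1 -> light X0 c2 w2 ->
    ~~ clash E g o h ind w1 c1 c2 -> ~~ clash E g o h ind w2 c2 c1 ->
    E c1 (g j b) w1 -> E c2 (g j (~~ b)) w2 -> w1 = w2.
  rewrite !inE => /andP [_ uj] calm1 calm2 c1j c2j l1 l2.
  move=> /norP [c12 /norP [h12 /negPn i21]] /norP [_ /norP [h21 /negPn i12]] E1 E2.
  exact: (pair_switch Ecl nofull st nE h0 hK k0 TE h_small fl f_small Areach nr0 a_open D0d X0d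
    uj calm1 calm2 c12 c1j c2j i12 l1 (lightW _ _ _ l1 h12) (lightW _ _ _ l2 h21) l2 E1 E2).
have free_labels j b l b' c c1 c2 w1 w2 : j \in J -> l \in J -> j != l ->
  c \in B -> c1 \in B -> c2 \in B -> c1 != c -> c2 != c ->
  c1 != j -> c2 != j -> c != j -> c1 != l -> c2 != l -> c != l ->
  ind c1 c -> ind c2 c -> w1 \notin heavy c -> w2 \notin heavy c ->
  light X0 c1 w1 -> light X0 c2 w2 ->
  ~~ clash E g o h ind w1 c1 c2 -> ~~ clash E g o h ind w2 c2 c1 ->
  E c1 (g j b) w1 -> E c2 (g l b') w2 -> E c (g j (~~ b)) (g l (~~ b')) -> w1 = w2.
  rewrite ![_ \in J]inE ![_ \in B]inE => /andP [_ uj] /andP [_ ul] jl calm0 calm1 calm2 c10 c20 c1j c2j c0j c1l c2l c0l.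
  move=> i10 i20 h10 h20 l1 l2.
  move=> /norP [c12 /norP [h12 /negPn i21]] /norP [_ /norP [h21 /negPn i12]] E1 E2 E0.
  exact: (free_two Ecl nofull st nE h0 hK k0 TE h_small fl f_small Areach nr0 a_open D0d X0d
    uj ul jl calm0 calm1 calm2 c12 c10 c20 c1j c2j c0j c1l c2l c0l i10 i12 i20
    l1 (lightW _ _ _ l1 h12) (lightW _ _ _ l1 h10) (lightW _ _ _ l2 h21) l2 (lightW _ _ _ l2 h20) E1 E2 E0).
have AB : #|A :\: B| <= d + 64 * k * d.
  apply: leq_trans (_ : #|D0 :|: [set c | n < 32 * k * via c X0]| <= _).
    apply: subset_leq_card; apply/subsetP => c; rewrite in_setD inE => /andP [nc cA].
    rewrite in_setU inE ltnNge; move: nc; rewrite /calm cA /=.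
    by case: (c \in D0) => //= ->.
  by apply: leq_trans (cardsU_leq _ _) _; apply: leq_add => //; apply: via_exceed.
have dbl j : j \in J -> #|[set c in A | doubled X0 c j]| <= q.
  move=> jJ; have := doubled_few heavy_at indQ pair_labels jJ; rewrite -QE => H.
  rewrite qE; apply: leq_trans (leq_add H AB); apply: leq_trans (cardsU_leq _ _).
  apply: subset_leq_card; apply/subsetP => c; rewrite inE => /andP [cA dc].
  by rewrite in_setU in_setD cA inE dc; case: (c \in B).
have AJ : #|A :\: J| <= #|A :\: typ| + d.
  apply: leq_trans (leq_add (leqnn _) D0d); apply: leq_trans (cardsU_leq _ _).
  apply: subset_leq_card; apply/subsetP => j; rewrite in_setD inE => /andP [nj jA].
  rewrite in_setU in_setD jA inE jA /= andbT; move: nj; rewrite jA /= /usable.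
  by case: (j \in D0); rewrite ?orbT //= orbF; apply: contra => H; apply: leq_trans H _; rewrite leq_mul2r orbT.
have exits c : c \in A -> exists S : {set V},
    [/\ n + #|uncov E g o c| <= #|S| + (3 * (2 * k + 1) + K + d),
      forall w, w \in S -> light X0 c w &
      exists phi : V -> C * bool, {in S &, injective phi} /\
        forall w, w \in S -> (phi w).1 != o /\ E c (g (phi w).1 (phi w).2) w].
  move=> cA; have [S [H1 H2 H3]] := legit_exits Ecl nofull nE Ecov h0 hK X0 (Alegit c cA).
  by exists S; split=> //; move: H1 X0d; clear; lia.
have A_sum : k * #|~: A| <= 60 * n.
  (* Nearly n exits of [c] are charged to blobs of the core, counted once, to doubled blobs, and to
     arcs leaving the core. The last two are few on average, so the core itself must have nearly n
     colours. *)
  have per c : c \in A -> n <= #|A| + (#|A :\: typ| + d) + (3 * (2 * k + 1) + K + d)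
      + 2 * #|outn leads c :&: ~: A| + #|outn (doubled X0) c :&: J|.
    move=> cA; have [S [H1 H2 [phi [inj H3]]]] := exits c cA.
    have H4 : #|S| <= #|outn leads c| + #|outn (doubled X0) c|.
      apply: leq_trans (@exits_leq _ _ E g o h X0 c S phi inj (fun w wS => conj (H2 w wS) (H3 w wS))) _.
      by rewrite leq_add2r; apply: subset_leq_card; apply: subsetIl.
    have H5 : #|outn leads c| <= #|A| + #|outn leads c :&: ~: A|.
      by rewrite -(cardsID A (outn _ _)) setDE leq_add2r subset_leq_card ?subsetIr.
    have H6 : #|outn (doubled X0) c| <= #|outn (doubled X0) c :&: J| + (#|A :\: J| + #|outn leads c :&: ~: A|).
      rewrite -(cardsID J (outn (doubled X0) c)) leq_add2l; apply: leq_trans (cardsU_leq _ _).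
      apply: subset_leq_card; apply/subsetP => j; rewrite in_setD => /andP [jJ].
      rewrite inE => dj; rewrite in_setU in_setD jJ in_setI in_setC.
      case: (j \in A) => //=; rewrite andbT inE.
      case/andP: dj => jo /existsP [w /existsP [w' /and5P [_ lw _ Ew _]]].
      apply/existsP; exists w; have /and3P [-> _ ->] := lw.
      by apply/adjP; split=> //; exists true.
    have := leq_trans (leq_addr _ n) H1.
    by move: H4 H5 H6 AJ; clear; lia.
  apply: (@complement_leq k n #|A| #|~: A| (arcs leads A (~: A)) #|A :\: typ| d q
    (3 * (2 * k + 1) + K + d)) => //.
  - by rewrite cardsC.
  - apply: leq_trans (sum_in_geq_const per) _.
    rewrite 2!big_split /= sum_nat_const -big_distrr /=; apply: leq_add => //.
    have -> : \sum_(c in A) #|outn (doubled X0) c :&: J| = arcs (doubled X0) A J by [].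
    rewrite arcs_swap; apply: leq_trans (_ : #|J| * q <= _); last by rewrite leq_mul2r (card_leq_n nE) orbT.
    by apply: sum_in_leq_const => j; apply: dbl.
  - by move: n_q; clear; lia.
have A_large : 2 * #|~: A| <= s.
  have := leq_mul k_large (leqnn #|~: A|); move: A_sum s_lower; clear; lia.
have [Sphi HS] : exists Sphi : C -> {set V} * (V -> C * bool), forall c, c \in B ->
   [/\ n + #|uncov E g o c| <= #|(Sphi c).1| + s, forall w, w \in (Sphi c).1 -> light X0 c w,
       {in (Sphi c).1 &, injective (Sphi c).2} &
       forall w, w \in (Sphi c).1 ->
         ((Sphi c).2 w).1 != o /\ E c (g ((Sphi c).2 w).1 ((Sphi c).2 w).2) w].
  have [|F HF] := @fin_all_exists C (fun=> ({set V} * (V -> C * bool))%type) (fun c X => c \in B ->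
   [/\ n + #|uncov E g o c| <= #|X.1| + s, forall w, w \in X.1 -> light X0 c w,
       {in X.1 &, injective X.2} &
       forall w, w \in X.1 -> (X.2 w).1 != o /\ E c (g (X.2 w).1 (X.2 w).2) w]).
    move=> c; case: (boolP (c \in B)) => [cB|_]; last by exists (set0, fun=> (o, true)).
    have cA : c \in A by move: cB; rewrite inE => /and3P [].
    have [S [H1 H2 [phi [H3 H4]]]] := exits c cA; exists (S, phi) => _; split=> //=.
    by apply: leq_trans H1 _; rewrite leq_add2l.
  by exists F.
have B_large : #|~: B| <= s.
  have sub : ~: B \subset ~: A :|: (A :\: B).
    by apply/subsetP => c; rewrite in_setU in_setD !in_setC => ->; case: (_ \in A).
  apply: leq_trans (subset_leq_card sub) (leq_trans (cardsU_leq _ _) (halves A_large _)).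
  by apply: leq_trans (leq_mul (leqnn 2) AB) _; move: s_q qE; clear; lia.
have J_large : #|~: J| <= s.
  have sub : ~: J \subset ~: A :|: (A :\: J).
    by apply/subsetP => c; rewrite in_setU in_setD !in_setC => ->; case: (_ \in A).
  apply: leq_trans (subset_leq_card sub) (leq_trans (cardsU_leq _ _) (halves A_large _)).
  apply: leq_trans (leq_mul (leqnn 2) AJ) _; apply: few_atypical typ_small s_lower _.
  by move: s_q qE; clear; lia.
apply: (@regular_exists C V E Ecl g o st n nE h X0 ind B J K (64 * k * K) heavyK heavy_at indQ oJ
  pair_labels free_labels (fun c => (Sphi c).1) (fun c => (Sphi c).2) s
  (16 * (1000 * 1000) * Q) (2 * (1000 * 1000) * K + 1)) => //.
- by move=> c /HS [].
- by move=> c w /HS [_ H _ _]; apply: H.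
- by move=> c /HS [].
- by move=> c w /HS [_ _ _ H]; apply: H.
- by move: s_pairs; clear; lia.
- by apply: leq_trans s_heavy; rewrite leq_mul2l leq_add2l X0d.
- rewrite -QE; apply: leq_trans (leq_mul s_lower (leqnn _)) _.
  by have := leq_mul (leqnn s) s_pairs; clear; lia.
- by rewrite addn1.
- by have := leq_mul s_lower (leqnn K); clear; lia.
- by rewrite -QE; have := leq_mul s_lower (leqnn Q); clear; lia.
Qed.
End Regular.

Theorem regular_structure_large : exists n0, forall n, n0 <= n ->
  forall (C V : finType) (E : C -> rel V), (forall c, clique_graph (E c)) ->
  (forall g, ~ full E g) -> forall (g : ends C V) (o : C), state E g o -> #|C| = n ->
  (forall c, 3 * n <= #|covered (E c)| + 2) ->
  exists (R : {set C}) (ctr : C -> V),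
  [/\ 50 * #|~: R| <= n, o \notin R & forall j, j \in R ->
    ctr j \in W g o /\ 4 * #|[set c | E c (g j true) (ctr j) && E c (g j false) (ctr j)]| > 3 * n].
Proof.
have [k kl] : exists k, 1000 * 1000 * 1000 <= k by eexists; apply: leqnn.
have [T TE] : exists T, T = 4 * k * k + 2 by eexists.
have [d dE] : exists d, d = 2 * k + 2 by eexists.
have [M ME] : exists M, M = 96 * k * (T + 2) by eexists.
have [K KE] : exists K, K = 8 * M by eexists.
have [f fE] : exists f, f = d + 2 * K + 3 * (T + 2) + 10 by eexists.
have [Q QE] : exists Q, Q = 1 + K + 64 * k * K by eexists.
have [q qE] : exists q, q = 16 * Q + 1 + (d + 64 * k * d) by eexists.
have [S1 S1E] : exists S, S = 100 * (16 * (1000 * 1000) * Q + (2 * (1000 * 1000) * K + 1) + 64 * k * K + 3) by eexists.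
have [S2 S2E] : exists S, S = 2 * (1000 * 1000) * (16 * Q + 1) by eexists.
have [S3 S3E] : exists S, S = 2 * (K + d) + (3 * (2 * k + 1) + K + d) + 4 * q by eexists.
have [N1 N1E] : exists S, S = 4 * k * (f + 1 + 16 * k * f) by eexists.
have [N2 N2E] : exists S, S = 100 * (3 * (2 * k + 1) + K) + 2 * k * (6 * k + 4) by eexists.
have [N3 N3E] : exists S, S = k * (q + 2 * d + (3 * (2 * k + 1) + K)) by eexists.
exists (1000 * 1000 * (S1 + S2 + S3 + 1) + M + N1 + N2 + N3 + 1) => n n_large C V E Ecl nofull g o st nE Ecov.
have M0 : 0 < M by rewrite ME !muln_gt0 addnS /= andbT; move: kl; clear; lia.
(* Rounding loses at most a factor 2, so n is below 2Mh; this is why [K = 8 * M] suffices for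
   [hK]. *)
pose h := n %/ M; pose s := n %/ (1000 * 1000).
have S0 : S1 + S2 + S3 + 1 <= s.
  by rewrite leq_divRL ?muln_gt0 // mulnC; move: n_large; clear; lia.
have s_upper : 1000 * 1000 * s <= n by rewrite mulnC leq_trunc_div.
have s_lower : n <= 2 * (1000 * 1000) * s.
  have : n < s.+1 * (1000 * 1000) by apply: ltn_ceil; rewrite muln_gt0.
  by move: S0; clear; lia.
have h0 : 0 < h by rewrite divn_gt0 //; move: n_large; clear; lia.
have hM : M * h <= n by rewrite mulnC leq_trunc_div.
have hK : 4 * n <= K * h.
  have : n < h.+1 * M by apply: ltn_ceil.
  by have := leq_mul (leqnn M) h0; rewrite KE; clear; lia.
apply: (@regular_structure C V E Ecl nofull g o st n nE Ecov h K k T f d s Q q h0 hK kl TE _ dE fE _ QE qE _ _ s_lower s_upper).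
- by rewrite -ME.
- by rewrite -N1E; move: n_large; clear; lia.
- by rewrite -N2E; move: n_large; clear; lia.
- by rewrite -N3E; move: n_large; clear; lia.
- by rewrite -S1E; move: S0; clear; lia.
- by rewrite -S2E; move: S0; clear; lia.
- by move: S0 S3E; clear; lia.
- by move: S0 S3E; clear; lia.
- by move: S0 S3E; clear; lia.
Qed.

(** * Colours of regular blobs *)

Section Contradiction.
Context (C V : finType) (E : C -> rel V).
Hypothesis Ecl : forall c, clique_graph (E c).
Hypothesis nofull : forall g, ~ full E g.
Context (g : ends C V) (o : C).
Hypothesis st : state E g o.
Context (n : nat).
Hypothesis nE : #|C| = n.
Hypothesis Ecov : forall c, 3 * n <= #|covered (E c)| + 2.
Hypothesis n_large : 1000 <= n.
Context (R : {set C}) (ctr : C -> V).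
Definition triangle c j := E c (g j true) (ctr j) && E c (g j false) (ctr j).
Hypothesis R_large : 50 * #|~: R| <= n.
Hypothesis oR : o \notin R.
Hypothesis ctrW : forall j, j \in R -> ctr j \in W g o.
Hypothesis ctr_many : forall j, j \in R -> 3 * n < 4 * #|[set c | triangle c j]|.

Local Notation W := (W g o).
Local Notation near := (near E g o).

Lemma R_other c : c \in R -> c != o.
Proof. by apply: contraTneq => ->. Qed.

Lemma triangle_edge c j b : triangle c j -> E c (g j b) (ctr j).
Proof. by case: b => /andP []. Qed.

Lemma triangle_few j : j \in R -> 4 * #|[set c | ~~ triangle c j]| <= n.
Proof.
move=> /ctr_many; have -> : [set c | ~~ triangle c j] = ~: [set c | triangle c j].
  by apply/setP => c; rewrite !inE.
by have := cardsC [set c | triangle c j]; rewrite nE; clear; lia.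
Qed.

Lemma triangle_pick j (Y : {set C}) : j \in R -> #|Y| <= 100 ->
  exists c, [/\ c \in R, triangle c j & c \notin Y].
Proof.
move=> jR Y100; have [c _ cN] : exists2 c, c \in [set: C] &
    c \notin [set c | ~~ triangle c j] :|: (~: R :|: Y).
  apply: subset_card_ltn_ex; rewrite cardsT nE.
  apply: leq_ltn_trans (cardsU_leq _ _) _.
  apply: leq_ltn_trans (leq_add (leqnn _) (cardsU_leq _ _)) _.
  by move: (triangle_few jR) R_large Y100 n_large; clear; lia.
move: cN; rewrite !in_setU in_setC => /norP [+ /norP [/negPn cR cY]].
by rewrite inE negbK => H; exists c.
Qed.

(** Two blobs with a common centre form triangles in a common colour, which would give the centre at
    least three neighbours. *)
Lemma ctr_inj : {in R &, injective ctr}.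
Proof.
move=> j j' jR j'R e; apply/eqP; apply: contraT => jj.
have [c _ cN] : exists2 c, c \in [set: C] &
    c \notin [set c | ~~ triangle c j] :|: [set c | ~~ triangle c j'].
  apply: subset_card_ltn_ex; rewrite cardsT nE.
  apply: leq_ltn_trans (cardsU_leq _ _) _.
  by move: (triangle_few jR) (triangle_few j'R) n_large; clear; lia.
move: cN; rewrite in_setU ![c \in _]inE => /norP [/negPn t1 /negPn t2].
have : #|[set (j, true); (j, false); (j', true)]| <= #|[set v | E c (ctr j) v]|.
  apply: (@card_inj_on _ _ _ _ (fun p => g p.1 p.2)) => [p p' Hp Hp' e'|p].
    have H q : q \in [set (j, true); (j, false); (j', true)] -> q.1 != o.
      by rewrite !inE => /orP [/orP []|] /eqP ->; rewrite /= R_other.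
    have [e1 e2] := state_inj st (H _ Hp) (H _ Hp') e'.
    by rewrite [p]surjective_pairing e1 e2 -surjective_pairing.
  rewrite !inE (E_sym Ecl) => /orP [/orP []|] /eqP -> /=; rewrite ?triangle_edge //.
  by rewrite e triangle_edge.
have -> : #|[set (j, true); (j, false); (j', true)]| = 3.
  by rewrite -setUA cardsU1 cards2 !inE !xpair_eqE !eqxx (negbTE jj).
by have := E_deg Ecl c (ctr j); clear; lia.
Qed.

Lemma ctr_fiber (X : {set V}) : #|[set c in R | ctr c \in X]| <= #|X|.
Proof.
apply: (card_inj_on (f := ctr)) => [c c'|c]; rewrite !inE => /andP [cR] //.
by move=> _ /andP [c'R _]; apply: ctr_inj.
Qed.

(* Two switches reach any regular colour [c]: leave the missing colour [i] towards some
   colour [l] in which the blob [c] is a triangle, then use the vertex [ctr c]. *)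
Lemma hop D X g' i c b (Y : {set C}) (Z : {set V}) : near D X g' i -> c \in R -> c \notin D ->
  ctr c \notin X -> #|D| <= 10 -> #|X| <= 10 -> #|Y| <= 10 -> #|Z| <= 10 ->
  exists l w g2, [/\ near (c |: (l |: D)) (ctr c |: (w |: X)) g2 c, l \notin Y, w \notin Z,
    free g2 c (g c b) & forall v, v \notin W -> free g' i v -> free g2 c v].
Proof.
move=> nr cR cD cX D10 X10 Y10 Z10.
pose X0 := ctr c |: (X :|: Z).
have X0s : #|X0| <= 21.
  rewrite /X0 cardsU1; have := cardsU_leq X Z; move: X10 Z10; case: (_ \notin _); clear; lia.
have leg : legit E g o 10 i by exists D, X, g'; split=> //; apply: leqW.
have h0 : 0 < 4 * n by move: n_large; clear; lia.
(* With the threshold 4n at most one vertex is heavy for a colour, so heaviness costs nothing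
   here. *)
have hK : 4 * n <= 1 * (4 * n) by rewrite mul1n.
have [S [S1 S2 [phi [inj S3]]]] := legit_exits Ecl nofull nE Ecov h0 hK X0 leg.
pose Bad := D :|: Y :|: ([set c] :|: [set l | ~~ triangle l c]).
(* [Bad] has about n/4 blobs, hence about n/2 ends, while there are nearly n exits at distinct
   ends. *)
have [w wS wB] : exists2 w, w \in S & (phi w).1 \notin Bad.
  apply/exists_inP; apply: contraT; rewrite negb_exists_in => /forall_inP H.
  have : #|S| <= #|setX Bad [set: bool]|.
    apply: (card_inj_on inj) => w wS; rewrite [phi w]surjective_pairing in_setX in_setT andbT.
    by have := H _ wS; rewrite negbK.
  rewrite cardsX cardsT card_bool.
  have : #|Bad| <= #|D| + #|Y| + (1 + #|[set l | ~~ triangle l c]|).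
    apply: leq_trans (cardsU_leq _ _) (leq_add (cardsU_leq _ _) _).
    by apply: leq_trans (cardsU_leq _ _) _; rewrite cards1.
  have := triangle_few cR; have := leq_trans (leq_addr _ n) S1.
  by move: X0s D10 Y10 n_large; clear; lia.
have [lo Ew] := S3 _ wS; have /and3P [wW wX0 _] := S2 _ wS.
move: lo Ew wB; set l := (phi w).1; set b' := (phi w).2 => lo Ew.
rewrite !in_setU in_set1 => /norP [/norP [lD lY] /norP [lc]]; rewrite inE negbK => tri.
move: wX0; rewrite in_setU1 in_setU => /norP [wc /norP [wX wZ]].
have [g1 [nr1 _ fr1]] := near_switch Ecl nr lD wW wX Ew.
have cD1 : c \notin l |: D by rewrite in_setU1 negb_or eq_sym lc.
have cX1 : ctr c \notin w |: X by rewrite in_setU1 negb_or eq_sym wc.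
have [g2 [nr2 fr2 fr3]] := near_switch Ecl nr1 cD1 (ctrW cR) cX1 (triangle_edge (~~ b) tri).
exists l, w, g2; split=> //; first by rewrite negbK in fr2.
by move=> v vW /(fr1 _ vW) /(fr3 _ vW).
Qed.

Lemma hop0 c b (Y : {set C}) (Z : {set V}) : c \in R -> #|Y| <= 10 -> #|Z| <= 10 ->
  exists l w g2, [/\ near [set c; l; o] [set ctr c; w] g2 c, l \notin Y, w \notin Z &
    free g2 c (g c b)].
Proof.
move=> cR Y10 Z10.
have [||||l [w [g2 [nr lY wZ fr _]]]] := hop b (near0 st) cR _ _ _ _ Y10 Z10;
  rewrite ?cards1 ?cards0 ?in_set1 ?in_set0 ?R_other //.
by exists l, w, g2; split=> //; move: nr; rewrite setU0 setUA.
Qed.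

(** Making [c] missing consumes only [ctr c] and one vertex of choice, so [u] and [u'] stay free. *)
Lemma W_stuck c u u' : c \in R -> u \in W -> u' \in W -> u != ctr c -> u' != ctr c ->
  E c u u' = false.
Proof.
move=> cR uW u'W uc u'c.
have [||l [w [g2 [[st2 _ _ _ fW] _ wZ _]]]] := @hop0 c true set0 [set u; u'] cR.
- by rewrite cards0.
- by rewrite cards2; case: (_ != _).
move: wZ; rewrite in_set2 => /norP [wu wu'].
by apply: (stuck Ecl nofull st2); apply: fW => //; rewrite in_set2 negb_or ?uc ?u'c eq_sym.
Qed.

Lemma end_stuck c b u : c \in R -> u \in W -> u != ctr c -> E c (g c b) u = false.
Proof.
move=> cR uW uc.
have [||l [w [g2 [[st2 _ _ _ fW] _ wZ fr]]]] := @hop0 c b set0 [set u] cR; rewrite ?cards0 ?cards1 //.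
rewrite in_set1 in wZ.
by apply: (stuck Ecl nofull st2 fr); apply: fW => //; rewrite in_set2 negb_or uc eq_sym.
Qed.

(** Here [ctr c] must stay free, so another colour [c1] with a triangle at the blob [c] is made
    missing. Moving [c] to the edge from [ctr c] to [u] frees both ends of its blob, and [c1] joins
    them. *)
Lemma ctr_stuck c u : c \in R -> u \in W -> E c (ctr c) u = false.
Proof.
move=> cR uW; apply/negP => Eu; have uc := E_neq Ecl Eu.
have [||c1 [c1R tri1 c1N]] := @triangle_pick c ([set c] :|: [set c1 in R | ctr c1 \in [set u; ctr c]]) => //.
  apply: leq_trans (cardsU_leq _ _) _; rewrite cards1.
  have := ctr_fiber [set u; ctr c]; rewrite cards2; case: (_ != _); clear; lia.
move: c1N; rewrite in_setU in_set1 inE c1R in_set2 => /norP [c1c /norP [c1u c1c']].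
have [||l [w [g2 [[st2 _ _ eqg fW] lY wZ _]]]] := @hop0 c1 true [set c] [set u; ctr c] c1R.
- by rewrite cards1.
- by rewrite cards2; case: (_ != _).
move: wZ lY; rewrite in_set1 in_set2 => /norP [wu wc] lc.
have cD : c \notin [set c1; l; o].
  by rewrite !inE !negb_or (eq_sym c c1) c1c (eq_sym c l) lc R_other.
have fu x : x \in W -> x != ctr c1 -> x != w -> free g2 c1 x.
  by move=> xW x1 xw; apply: fW; rewrite // in_set2 negb_or x1.
have cc1 : c != c1 by rewrite eq_sym.
have [||st3 fr3 _] := swap_edge Ecl st2 cc1 _ _ Eu.
- by apply: fu; rewrite ?ctrW // eq_sym.
- by apply: fu => //; rewrite eq_sym.
have E1 : E c1 (g c true) (g c false).
  apply: (E_trans Ecl (triangle_edge true tri1)); first by rewrite (E_sym Ecl) triangle_edge.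
  by apply: (E_neq Ecl (state_ends Ecl true st _)); rewrite R_other.
have ft := fr3 true; have ff := fr3 false; rewrite !eqg // in ft ff.
by rewrite (stuck Ecl nofull st3 ft ff) in E1.
Qed.

(** Away from [ctr c] there are at least n-1 covered vertices of [W]. They sit at distinct ends of
    blobs other than [o] and [c], and there are only n-2 such blobs. *)
Lemma two_hits c : c \in R -> exists j w w',
  [/\ j != o, j != c & [/\ w \in W, w' \in W, w != w', w != ctr c & w' != ctr c] /\
   E c (g j true) w /\ E c (g j false) w'].
Proof.
move=> cR; pose S := covered (E c) :&: W :\ ctr c.
have S_large : n - 1 <= #|S|.
  have := covered_free g o nE Ecov c; rewrite (cardsD1 (ctr c) (_ :&: _)) -/S.
  by case: (_ \in _); clear; lia.
have [|phi Hphi] := @ex_fin_choice V (C * bool)%type (o, true) (fun w => w \in S)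
   (fun w p => [/\ p.1 != o, p.1 != c & E c (g p.1 p.2) w]).
  move=> w; rewrite in_setD1 in_setI => /andP [wc /andP [+ wW]].
  rewrite inE => /existsP [u Euw].
  have uW : u \notin W.
    apply: contraL Euw => uW; case: (eqVneq u (ctr c)) => [->|uc]; first by rewrite ctr_stuck.
    by rewrite W_stuck.
  move: uW; rewrite inE => /not_freeP [j [b [jo e]]]; exists (j, b); split; rewrite //= ?e //.
  by apply: contraL Euw => /eqP jc; rewrite -e jc end_stuck.
have SE w : w \in S -> w \in W /\ w != ctr c.
  by rewrite in_setD1 in_setI => /andP [-> /andP [_ ->]].
have inj : {in S &, injective phi}.
  move=> w w' wS w'S e; apply/eqP; apply: contraT => ww'.
  have [_ _ E1] := Hphi _ wS; have [_ _ E2] := Hphi _ w'S.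
  have : E c w w' by apply: (E_trans Ecl _ E2 ww'); rewrite -e (E_sym Ecl).
  by have [wW wc] := SE _ wS; have [w'W w'c] := SE _ w'S; rewrite W_stuck.
have H : #|[set j | ((j, true) \in phi @: S) || ((j, false) \in phi @: S)]| <= n - 2.
  have <- : #|~: [set o; c]| = n - 2.
    by rewrite cardsCs setCK cards2 nE eq_sym R_other.
  apply: subset_leq_card; apply/subsetP => j; rewrite inE in_setC in_set2 negb_or.
  by case/orP => /imsetP [w wS e]; have [] := Hphi _ wS; rewrite -e => -> ->.
have := card_pairs (phi @: S); rewrite (card_in_imset inj).
case: (set_0Vmem [set j | ((j, true) \in phi @: S) && ((j, false) \in phi @: S)]) => [->|[j]].
  rewrite cards0 addn0 => e; suff : n - 1 <= n - 2 by move: n_large; clear; lia.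
  by apply: leq_trans S_large _; rewrite e.
rewrite inE => /andP [/imsetP [w wS e] /imsetP [w' w'S e']] _.
have [jo jc Ew] := Hphi _ wS; have [_ _ Ew'] := Hphi _ w'S.
have [wW wc] := SE _ wS; have [w'W w'c] := SE _ w'S.
exists j, w, w'; rewrite -e -?e' in jo jc Ew Ew'; split=> //; split=> //; split=> //.
by apply/eqP => ww; move: e'; rewrite -ww -e.
Qed.

(** After [c1] is made missing and switches the blob [j] through [w], the end [g j (~~ b)] is free.
    A hop to [c2] preserves it, and the edge to [w'] extends the matching. *)
Lemma two_colours c1 c2 j b w w' : c1 \in R -> c2 \in R -> c1 != c2 -> j != o ->
  j != c1 -> j != c2 -> w \in W -> w' \in W -> w != w' ->
  w \notin [set ctr c1; ctr c2] -> w' \notin [set ctr c1; ctr c2] ->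
  E c1 (g j b) w -> E c2 (g j (~~ b)) w' -> False.
Proof.
move=> c1R c2R c12 jo j1 j2 wW w'W ww'.
rewrite !in_set2 => /norP [w1 w2] /norP [w'1 w'2] E1 E2.
have [||l [x [g1 [nr1 lY xZ _]]]] := @hop0 c1 true [set j; c2] [set w; w'; ctr c2] c1R.
- by rewrite cards2; case: (_ != _).
- by apply: leq_trans (cardsU_leq _ _) _; rewrite cards1 cards2; case: (_ != _).
move: lY xZ; rewrite !inE => /norP [lj l2] /norP [/norP [xw xw'] x2].
have [|| g2 [nr2 fr2 _]] := near_switch Ecl nr1 (j := j) _ wW _ E1.
- by rewrite !inE !negb_or j1 jo (eq_sym j l) lj.
- by rewrite !inE negb_or w1 (eq_sym w x).
have [||||||l2' [y [g3 [[st3 _ _ _ fW] _ yZ _ fr3]]]] := @hop _ _ g2 j c2 true set0 [set w'] nr2 c2R.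
- by rewrite !inE !negb_or (eq_sym c2 j) j2 (eq_sym c2 c1) c12 (eq_sym c2 l) l2 R_other.
- rewrite !inE !negb_or (eq_sym _ w) w2 (eq_sym _ x) x2 andbT /=.
  by apply: contra c12 => /eqP e; rewrite (ctr_inj c1R c2R) // e.
- apply: leq_trans (cardsU_leq _ _) (leq_trans (leq_add (leqnn _) (cardsU_leq _ _)) _).
  by rewrite !cards1 cards2; case: (_ != _).
- by apply: leq_trans (cardsU_leq _ _) _; rewrite cards1 cards2; case: (_ != _).
- by rewrite cards0.
- by rewrite cards1.
rewrite in_set1 in yZ.
have fj : free g3 c2 (g j (~~ b)).
  apply: fr3 => //; rewrite inE; apply/not_freeP; by exists j, (~~ b).
have fw' : free g3 c2 w'.
  apply: fW => //; rewrite !inE !negb_or w'2 (eq_sym w' y) yZ (eq_sym w' w) ww' w'1 /=.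
  by rewrite eq_sym.
by rewrite (stuck Ecl nofull st3 fj fw') in E2.
Qed.

Theorem no_regular_structure : False.
Proof.
have [|F HF] := @ex_fin_choice C (C * (V * V))%type (o, (g o true, g o true)) (fun c => c \in R)
  (fun c x => let: (j, (w, w')) := x in
    [/\ j != o, j != c & [/\ w \in W, w' \in W, w != w', w != ctr c & w' != ctr c] /\
   E c (g j true) w /\ E c (g j false) w']).
  by move=> c /two_hits [j [w [w' H]]]; exists (j, (w, w')).
pose J c := (F c).1; pose f1 c := (F c).2.1; pose f2 c := (F c).2.2.
have HJ c : c \in R -> [/\ J c != o, J c != c &
   [/\ f1 c \in W, f2 c \in W, f1 c != f2 c, f1 c != ctr c & f2 c != ctr c] /\
   E c (g (J c) true) (f1 c) /\ E c (g (J c) false) (f2 c)].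
  by move=> /HF; rewrite /J /f1 /f2; case: (F c) => j [w w'].
(* A regular blob would supply a second colour [c2] with a triangle there. One of the two hits of
   [c] avoids the centre of the blob, and [c2] joins the opposite end to the centre. *)
have JR c : c \in R -> J c \in ~: R.
  move=> cR; have [jo jc [[w1W w2W w12 w1c w2c] [E1 E2]]] := HJ c cR.
  rewrite in_setC; apply/negP => jR.
  have [|c2 [c2R tri2]] := @triangle_pick (J c) ([set c; J c] :|: [set c2 in R | ctr c2 \in [set f1 c; f2 c]]) jR.
    apply: leq_trans (cardsU_leq _ _) _; have := ctr_fiber [set f1 c; f2 c].
    by rewrite !cards2; do 2!case: (_ != _); clear; lia.
  rewrite in_setU in_set2 [_ \in [set c2 in R | _]]inE c2R in_set2 => /norP [/norP [c2c c2j] /norP [n1 n2]].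
  have [b [w [wW wc w2 wj Ew]]] : exists b w, [/\ w \in W, w != ctr c, w != ctr c2, w != ctr (J c) & E c (g (J c) b) w].
    case: (eqVneq (f1 c) (ctr (J c))) => [e|ne].
      by exists false, (f2 c); split=> //; rewrite eq_sym // -e.
    by exists true, (f1 c); split=> //; rewrite eq_sym.
  apply: (@two_colours c c2 (J c) b w (ctr (J c))) => //.
  - by rewrite eq_sym.
  - by rewrite eq_sym.
  - exact: ctrW.
  - by rewrite in_set2 negb_or wc.
  - rewrite in_set2 negb_or; apply/andP; split.
      by apply: contra jc => /eqP e; rewrite (ctr_inj jR cR) // e.
    by apply: contra c2j => /eqP e; rewrite (ctr_inj jR c2R) // e.
  - exact: triangle_edge.
pose Fib j := [set c in R | J c == j].
(* On a larger fibre [common_label] with [Q = 3] and [t = 6] makes both hits equal to one vertex for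
   some colour. The 3 counts the colour itself and the at most two colours centred at its hits. *)
have Fib_small j : #|Fib j| <= 24.
  rewrite leqNgt; apply/negP => big.
  pose B c1 c2 := (c1 == c2) || ((c2 \in R) && (ctr c2 \in [set f1 c1; f2 c1])).
  have BQ x : #|[set y | B x y]| <= 3.
    apply: leq_trans (_ : #|[set x] :|: [set c in R | ctr c \in [set f1 x; f2 x]]| <= _).
      by apply: subset_leq_card; apply/subsetP => y; rewrite inE in_setU in_set1 eq_sym [_ \in [set c in R | _]]inE.
    apply: leq_trans (cardsU_leq _ _) _; rewrite cards1; have := ctr_fiber [set f1 x; f2 x].
    by rewrite cards2; case: (_ != _); clear; lia.
  have [|||||w [H1 H2]] := @common_label C V (Fib j) (Fib j) f1 f2 B 3 6 BQ => //.
  - move=> c1 c2; rewrite inE => /andP [c1R /eqP e1]; rewrite inE => /andP [c2R /eqP e2].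
    rewrite /B c1R c2R /= !in_set2 => /norP [c12 /norP [n1 n2]] /norP [_ /norP [n3 n4]].
    have [jo jc1 [[w1W _ _ w1c _] [E1 _]]] := HJ c1 c1R.
    have [_ jc2 [[_ w2W _ _ w2c] [_ E2]]] := HJ c2 c2R.
    apply/eqP; apply: contraT => ne; rewrite e1 in jo jc1 E1; rewrite e2 in jc2 E2.
    case: (@two_colours c1 c2 j true (f1 c1) (f2 c2)) => //.
      by rewrite in_set2 negb_or w1c eq_sym.
    by rewrite in_set2 negb_or w2c andbT eq_sym.
  - by clear; lia.
  - by clear; lia.
  have [c cF cN] : exists2 c, c \in Fib j & c \notin [set c in Fib j | f1 c != w] :|: [set c in Fib j | f2 c != w].
    apply: subset_card_ltn_ex; apply: leq_ltn_trans (cardsU_leq _ _) _.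
    by move: H1 H2 big; clear; lia.
  move: cN; rewrite in_setU inE cF [_ \in [set c in Fib j | f2 c != w]]inE cF => /norP [/negPn /eqP e1 /negPn /eqP e2].
  have cR : c \in R by move: cF; rewrite inE => /andP [].
  by have [_ _ [[_ _ + _ _] _]] := HJ c cR; rewrite e1 e2 eqxx.
have : #|R| <= #|~: R| * 24.
  apply: leq_trans (_ : #|[set c | [exists j in ~: R, (c \in R) && (J c == j)]]| <= _).
    apply: subset_leq_card; apply/subsetP => c cR; rewrite inE; apply/exists_inP.
    by exists (J c); rewrite ?JR // cR eqxx.
  by apply: card_exists_leq => j _; apply: Fib_small.
by have := cardsC R; rewrite nE; move: R_large n_large; clear; lia.
Qed.
End Contradiction.

(** * From multigraphs to full matchings *)

Section Partial.
Context (C V : finType) (E : C -> rel V).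
Hypothesis Ecl : forall c, clique_graph (E c).

Definition matching_on (S : {set C}) (g : ends C V) : Prop :=
  (forall c, c \in S -> E c (g c true) (g c false)) /\
  (forall c b c' b', c \in S -> c' \in S -> g c b = g c' b' -> c = c' /\ b = b').

Lemma maximal_matching (v0 : V) : exists (S : {set C}) g,
  matching_on S g /\ forall S' g', matching_on S' g' -> #|S'| <= #|S|.
Proof.
pose P (S : {set C}) := holds (exists g, matching_on S g).
have P0 : P set0 by apply/holdsP; exists (fun _ _ => v0); split=> [c|c b c' b']; rewrite inE.
case: (arg_maxnP (fun S : {set C} => #|S|) P0) => S /holdsP [g gS] max.
by exists S, g; split=> // S' g' H; apply: max; apply/holdsP; exists g'.
Qed.

(** Every edge of the missing colour meets the set of at most 2|C| ends, and each end has at most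
    two neighbours in that colour. This shows that a maximal matching cannot be small. *)
Lemma covered_few g o : (forall g, ~ full E g) -> state E g o -> #|covered (E o)| <= 6 * #|C|.
Proof.
move=> nofull st; pose U := [set g p.1 p.2 | p : C * bool].
have U2 : #|U| <= 2 * #|C|.
  by apply: leq_trans (leq_imset_card _ _) _; rewrite card_prod card_bool mulnC.
apply: leq_trans (_ : #|U :|: [set v | [exists u in U, E o u v]]| <= _).
  apply: subset_leq_card; apply/subsetP => v; rewrite inE => /existsP [u Euv].
  have HU x : x \notin U -> free g o x.
    move=> xU; apply/freeP => c b _; apply: contra xU => /eqP <-.
    by apply/imsetP; exists (c, b).
  rewrite in_setU; case: (boolP (v \in U)) => //= vU; rewrite inE.
  case: (boolP (u \in U)) => uU; first by apply/exists_inP; exists u.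
  by rewrite (stuck Ecl nofull st (HU _ uU) (HU _ vU)) in Euv.
apply: leq_trans (cardsU_leq _ _) _.
have : #|[set v | [exists u in U, E o u v]]| <= #|U| * 2.
  by apply: card_exists_leq => u _; apply: E_deg.
by move: U2; clear; lia.
Qed.
End Partial.

Theorem full_exists : exists n0, forall n, n0 <= n ->
  forall (C V : finType) (E : C -> rel V), (forall c, clique_graph (E c)) -> #|C| = n ->
  (forall c, 3 * n <= #|covered (E c)| + 2) -> exists g, full E g.
Proof.
have [N HN] := regular_structure_large.
exists (2 * (N + 1000) + 1) => n n_large C V E Ecl nE Ecov.
have [v0 _] : exists v0 : V, true.
  have /card_gt0P [c _] : 0 < #|C| by rewrite nE; move: n_large; clear; lia.
  have /card_gt0P [v _] : 0 < #|covered (E c)| by have := Ecov c; move: n_large; clear; lia.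
  by exists v.
have [S [g [[Eg inj] max]]] := maximal_matching E v0.
case: (set_0Vmem (~: S)) => [S0|[i]].
  have H c : c \in S by rewrite -[S]setCK S0 !inE.
  by exists g; split=> [c|c b c' b']; [apply: Eg | apply: inj].
rewrite inE => iS; exfalso; pose T := i |: S.
have iT : i \in T by rewrite in_setU1 eqxx.
pose C' : finType := {c | c \in T}; pose E' (c : C') := E (val c).
pose g' (c : C') := g (val c); pose o : C' := exist _ i iT.
have Ecl' c : clique_graph (E' c) by apply: Ecl.
have inS (c : C') : c != o -> val c \in S.
  have : val c \in T by apply: valP.
  rewrite in_setU1 => /orP [/eqP e|//] /eqP []; exact: val_inj.
have st : state E' g' o.
  split=> [c /inS cS|c b c' b' /inS cS /inS c'S e]; first exact: Eg.
  by have [/val_inj -> ->] := inj _ _ _ _ cS c'S e.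
have C'T : #|C'| = #|T| by rewrite card_sig; apply: eq_card => x; rewrite inE.
have nofull f : ~ full E' f.
  move=> [Ef injf]; pose f' c b := if insub c is Some c' then f c' b else v0.
  have fE (c : C') b : f' (val c) b = f c b by rewrite /f' valK.
  suff /max : matching_on E T f' by rewrite cardsU1 iS; clear; lia.
  split=> [c cT|c b c' b' cT c'T].
    by have := Ef (exist _ c cT); rewrite -!fE.
  have := injf (exist _ c cT) b (exist _ c' c'T) b'; rewrite -!fE /= => H e.
  by have [ec ->] := H e; split=> //; have := congr1 val ec.
have few := covered_few Ecl' nofull st.
have Tn : #|C'| <= n by rewrite C'T -nE max_card.
have big : N + 1000 <= #|C'|.
  by have := leq_trans (Ecov i) (leq_add few (leqnn 2)); move: n_large; clear; lia.
have Ecov' c : 3 * #|C'| <= #|covered (E' c)| + 2.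
  by apply: leq_trans (Ecov (val c)); rewrite leq_mul2l.
have big1 : N <= #|C'| := leq_trans (leq_addr _ _) big.
have [R [ctr [R1 R2 R3]]] := HN _ big1 C' V E' Ecl' nofull g' o st erefl Ecov'.
apply: (@no_regular_structure C' V E' Ecl' nofull g' o st #|C'| erefl Ecov' _ R ctr) => //.
- by apply: leq_trans big; apply: leq_addl.
- by move=> j /R3 [].
- by move=> j /R3 [].
Qed.

(** * Cutting cliques into edges and triangles *)

Section Refinement.
Context (V : finType) (P : {set {set V}}).
Hypothesis Ptriv : trivIset P.
Hypothesis Pbig : forall B, B \in P -> 2 <= #|B|.

(* Cuts a clique into consecutive pairs, the last of which may be a triple. *)
Definition piece (B : {set V}) u := minn (index u (enum B) %/ 2) (#|B| %/ 2 - 1).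

Definition refined : rel V := fun u v =>
  [&& u != v, v \in pblock P u & piece (pblock P u) u == piece (pblock P u) v].

Lemma refined_block u v : refined u v ->
  [/\ pblock P v = pblock P u, u \in pblock P u & pblock P u \in P].
Proof.
case/and3P => _ vB _.
have uP : u \in cover P.
  move: vB; rewrite /pblock; case: pickP => [B /andP [BP uB] _|_]; last by rewrite inE.
  by apply/bigcupP; exists B.
split; rewrite ?mem_pblock ?pblock_mem //.
exact: (same_pblock Ptriv vB).
Qed.

Lemma refined_clique : clique_graph refined.
Proof.
split.
- have H u v : refined u v -> refined v u.
    move=> uv; have [e uB _] := refined_block uv; case/and3P: uv => ne _ /eqP ep.
    by rewrite /refined e eq_sym ne uB ep eqxx.
  by move=> u v; apply/idP/idP; apply: H.
- by move=> u; rewrite /refined eqxx.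
- move=> u v w uv vw uw; have [e uB _] := refined_block uv.
  case/and3P: uv => _ _ /eqP e1; case/and3P: vw; rewrite e => _ wB /eqP e2.
  by rewrite /refined uw wB e1 e2 eqxx.
move=> u; rewrite -ltnS; set B := pblock P u.
case: (boolP [exists v, refined u v]) => [/existsP [v0 /refined_block [_ uB BP]]|/existsPn H]; last first.
  rewrite (_ : [set v | refined u v] = set0) ?cards0 //.
  by apply/setP => v; rewrite !inE; apply/negbTE.
rewrite -/B in uB BP.
have idx v : v \in B -> index v (enum B) < #|B| by rewrite cardE index_mem mem_enum.
have : #|u |: [set v | refined u v]| <= #|'I_3|.
  have sub v : v \in u |: [set v | refined u v] -> v \in B /\ piece B u = piece B v.
    rewrite in_setU1 inE => /orP [/eqP ->|/and3P [_ vB /eqP]] //.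
  (* The position inside a piece is 0, 1 or 2, the value 2 occurring only in the last piece of an
     odd clique. *)
  pose f v : 'I_3 := inord (index v (enum B) - 2 * piece B u).
  rewrite -cardsT; apply: (card_inj_on (f := f)) => // v w /sub [vB ev] /sub [wB ew].
  move=> /(congr1 val); have := idx _ vB; have := idx _ wB; have := Pbig BP.
  move: ev ew; rewrite /f /piece /= => ev ew B2 w_lt v_lt.
  rewrite !inordK ?ltnS; [|lia|lia] => e.
  have ei : index v (enum B) = index w (enum B) by lia.
  by rewrite -[v](nth_index u (s := enum B)) ?mem_enum // ei nth_index ?mem_enum.
by rewrite cardsU1 card_ord inE /refined eqxx /= add1n.
Qed.

Lemma refined_covered : cover P \subset covered refined.
Proof.
apply/subsetP => u uP; rewrite inE.
have uB : u \in pblock P u by rewrite mem_pblock.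
have BP : pblock P u \in P by rewrite pblock_mem.
set B := pblock P u in uB BP; have B2 := Pbig BP.
have idx : index u (enum B) < #|B| by rewrite cardE index_mem mem_enum.
set i := index u (enum B) in idx.
(* An odd position is paired with its predecessor, an even one with its successor; the last vertex
   of an odd clique falls back to its predecessor in the triple. *)
pose i' := if odd i then i - 1 else if i.+1 < #|B| then i.+1 else i - 1.
have [i'B i'i] : i' < #|B| /\ i' != i.
  by rewrite /i'; case: ifP => oi; [|case: ifP => ?]; split; try lia; apply/eqP; lia.
pose v := nth u (enum B) i'.
have iv : index v (enum B) = i' by rewrite index_uniq ?enum_uniq // -cardE.
have vB : v \in B by rewrite -mem_enum mem_nth // -cardE.
have vu : v != u by apply: contra i'i => /eqP e; rewrite -iv e.
suff H : refined u v.
  apply/existsP; exists v; by have [-> _ _ _] := refined_clique.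
rewrite /refined eq_sym vu -/B vB /piece iv -/i /=; apply/eqP.
by rewrite /i'; case: ifP => oi; [|case: ifP => ?]; lia.
Qed.
End Refinement.

Theorem mainTheorem1 :
  exists n0 : nat, forall n : nat, n0 <= n ->
    forall (V : finType) (M : {set 'I_n * {set V}}),
      nv_multigraph (3 * n - 2) M ->
      exists R : {set 'I_n * {set V}},
        [/\ R \subset M, rainbow_matching R & #|R| = n].
Proof.
have [n0 Hn0] := full_exists.
exists n0 => n n_large V M [_ HM].
have [P HP] := fin_all_exists HM.
pose E c := refined (P c).
have Ecl c : clique_graph (E c) by have [[? ? _] _] := HP c; apply: refined_clique.
have [||g [Eg inj]] := Hn0 n n_large 'I_n V E Ecl; first exact: card_ord.
  move=> c; have [[triv big _] cov] := HP c.
  have := leq_trans cov (subset_leq_card (refined_covered triv big)).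
  by rewrite leq_subLR addnC.
have EM c u v : E c u v -> (c, [set u; v]) \in M.
  move=> uv; have [[triv big cls] _] := HP c.
  have [_ uB BP] := refined_block triv uv; have /and3P [ne vB _] := uv.
  have : [set u; v] \in colour_class M c.
    rewrite cls inE /is_edge cards2 ne; apply/exists_inP; exists (pblock (P c) u) => //.
    by rewrite subUset !sub1set uB.
  case/imsetP => -[c' e]; rewrite inE /= => /andP [eM /eqP ec] ->.
  by rewrite -ec.
pose edge c := (c, [set g c true; g c false]).
exists [set edge c | c : 'I_n]; split.
- by apply/subsetP => _ /imsetP [c _ ->]; apply: EM.
- move=> _ _ /imsetP [c _ ->] /imsetP [c' _ ->] ne.
  have cc : c != c' by apply: contraNneq ne => ->.
  split=> //=; rewrite disjoint_subset; apply/subsetP => x; rewrite !inE.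
  have H b b' : g c b != g c' b'.
    by apply: contra cc => /eqP /inj [-> _].
  by case/orP => /eqP ->; rewrite negb_or !H.
- by rewrite card_imset ?card_ord // => c c' [].
Qed.
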